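(* Let $k,l\geq 1$ and let $S_{k,l}$ be the double star, and let $p(x)=x(x-k-1)(x-l-1)-(x-1)(x-k-1)-(x-1)(x-l-1)$. (1) Let $v$ be the vertex of $S_{k,l}$ of degree $k+1$. Then $\uparrow^{2}S_{k,l}$ has Laplacian pretty good state transfer between $(0,v)$ and $(1,v)$ if and only if $p(x)$ is irreducible over $\mathbb{Q}$ and $\nu_2(k+1)=\nu_2(l+3)$. (2) Let $w$ be a leaf of $S_{k,l}$ attached to the vertex of degree $l+1$. Then $\uparrow^{2}S_{k,l}$ has Laplacian pretty good state transfer between $(0,w)$ and $(1,w)$ if and only if $l=1$, $k$ is odd, and either $p(x)$ is irreducible over $\mathbb{Q}$ or $p(x)$ has a root that is an even integer.
   Context: The double star $S_{k,l}$ is the tree obtained from $K_2$ (with vertices $x,y$) by attaching $k$ pendent vertices to $x$ and $l$ pendent vertices to $y$; its Laplacian characteristic polynomial is $x(x-1)^{k+l-2}p(x)$. For a nonzero integer $n$, $\nu_2(n)$ is the exponent of the largest power of $2$ dividing $n$. The blow-up $\uparrow^{2}G$ has vertex set $\mathbb{Z}_2\times V(G)$, with $(a,u)\sim(b,v)$ iff $u\sim v$ in $G$. A graph with Laplacian $L=D-A$ has Laplacian pretty good state transfer between vertices $a,b$ if there exist $\{t_k\}\subseteq\mathbb{R}$ and $\gamma\in\mathbb{C}$ with $\lim_{k\to\infty}\exp(it_kL)\mathbf{e}_a=\gamma\mathbf{e}_b$. *)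

(* Defs.v *)
From HB Require Import structures.
From mathcomp Require Import all_boot all_order all_algebra.
From mathcomp Require Import all_classical all_reals all_analysis.
From mathcomp.real_closed Require Import complex.
Set Implicit Arguments. Unset Strict Implicit. Unset Printing Implicit Defensive.
Import Order.TTheory GRing.Theory Num.Theory.
Import numFieldNormedType.Exports.
Local Open Scope ring_scope.
Local Open Scope complex_scope.
Local Open Scope classical_set_scope.

(** Simple graphs: a finite vertex type [V] with a symmetric irreflexive
    adjacency relation [adj]. Matrices indexed by vertices use the
    enumeration [enum_rank : V -> 'I_#|V|]. *)

Definition laplacian (C : nzRingType) (V : finType) (adj : rel V) : 'M[C]_#|V| :=
  \matrix_(i, j)
    ((if enum_val i == enum_val j then #|[set w | adj (enum_val i) w]|%:R else 0)
     - (adj (enum_val i) (enum_val j))%:R).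

(** Complex n x n matrices, seen as a normed module over R[i]
    (so that limits of matrices make sense). *)
Definition CMat (R : realType) (n : nat) : normedModType (R[i]) := 'M[R[i]]_n.
Definition CVec (R : realType) (n : nat) : normedModType (R[i]) := 'cV[R[i]]_n.

Definition expmx (R : realType) (n : nat) (A : 'M[R[i]]_n) : CMat R n :=
  limn (series (fun k : nat => ((k`!)%:R)^-1 *: A ^+ k : CMat R n)).

Definition evec (R : realType) (n : nat) (a : 'I_n) : CVec R n := delta_mx a 0.

Definition LPGST (R : realType) (V : finType) (adj : rel V) (a b : V) : Prop :=
  exists (t : nat -> R) (gamma : R[i]),
    (fun k => (expmx (('i * (t k)%:C) *: laplacian R[i] adj) *m
                 evec R (enum_rank a) : CVec R #|V|)) @ \oo
      --> (gamma *: evec R (enum_rank b) : CVec R #|V|).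

(** The double star S_{k,l}: vertex set {0,...,k+l+1}; vertex 0 is x,
    vertex 1 is y, vertices 2..k+1 are the k leaves attached to x and
    vertices k+2..k+l+1 are the l leaves attached to y. *)
Definition dstar_adj0 (k l : nat) (i j : 'I_(k + l + 2)) : bool :=
  [|| (i == 0 :> nat) && (j == 1 :> nat),
      (i == 0 :> nat) && (2 <= j < k + 2)%N |
      (i == 1 :> nat) && (k + 2 <= j)%N].
Definition dstar_adj (k l : nat) : rel 'I_(k + l + 2) :=
  fun i j => dstar_adj0 i j || dstar_adj0 j i.

Definition blowup2 (V : finType) (adj : rel V) : rel ('I_2 * V)%type :=
  fun x y => adj x.2 y.2.

Definition dstar_p (k l : nat) : {poly rat} :=
  'X * ('X - (k.+1)%:R%:P) * ('X - (l.+1)%:R%:P)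
  - ('X - 1) * ('X - (k.+1)%:R%:P) - ('X - 1) * ('X - (l.+1)%:R%:P).

Definition nu2 (n : nat) : nat := logn 2 n.

(* Main.v *)
Require Import Defs.
From HB Require Import structures.
From mathcomp Require Import all_boot all_order all_algebra.
From mathcomp Require Import all_classical all_reals all_analysis.
From mathcomp.real_closed Require Import complex.
From mathcomp Require Import ring lra zify.
From mathcomp.real_closed Require polyrcf.
Set Implicit Arguments. Unset Strict Implicit. Unset Printing Implicit Defensive.
Import Order.TTheory GRing.Theory Num.Theory.
Import numFieldNormedType.Exports.
Local Open Scope ring_scope.
Local Open Scope complex_scope.
Local Open Scope classical_set_scope.

(** A vector on the blow-up splits into a part that is equal on both copies and a part
of opposite signs. On the first the Laplacian acts as twice that of the double star, on
the second as twice the degree. So state transfer between the copies of [v] means: there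
are times along which [exp (i t x)] tends to 1 for every eigenvalue [x] in the support
of [e_v], while [exp (i t d)] tends to -1 for the degree [d] of [v].

For the hub, and for the leaf when [l = 1], the support is 0 and the three roots of [p];
for [l > 1] it also contains the degree 1 of the leaf, which excludes transfer. The roots
sum to [k + l + 4], which gives the parity conditions. With [b] the larger of [k + 1] and
[l + 1], the roots lie in ]0,1[, ]1,b+1[ and ]b+1,b+2[; this forces an integer root to be
the middle one and equal to the smaller of [k + 1] and [l + 1], so [p] is irreducible
exactly when [k <> l]. In that case 1 and two of the roots are linearly independent over
the rationals, and Kronecker's theorem provides the times; for [k = l = 1] the roots are
2 and 2 ± sqrt 2, and solutions of Pell's equation do. *)

(** * The exponential of a complex matrix *)

Lemma normc_le_ReIm (R : realType) (z : R[i]) :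
  `|z| <= (`|complex.Re z| + `|complex.Im z|)%:C.
Proof.
rewrite [X in `|X|]complexE (le_trans (ler_normD _ _))//.
rewrite rmorphD/= lerD//; first by rewrite normc_def/= expr0n/= addr0 sqrtr_sqr.
by rewrite normrM normc_def/= expr0n expr1n/= add0r sqrtr1 mul1r normc_def/= expr0n/= addr0 sqrtr_sqr.
Qed.

Lemma normc_ge_Im (R : realType) (z : R[i]) : `|complex.Im z|%:C <= `|z|.
Proof.
by rewrite normc_def lecR -sqrtr_sqr ler_wsqrtr// lerDr sqr_ge0.
Qed.

(** Balls of matrices are entrywise, and a modulus lies between each of the two parts and the sum of
    their absolute values. All limits thus become real ones, where [cos] and [sin] are available. *)
Lemma cvg_mxP (R : realType) (m n : nat)
    (M : nat -> ('M[R[i]]_(m, n) : normedModType R[i]))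
    (L : ('M[R[i]]_(m, n) : normedModType R[i])) :
  (M @ \oo --> L) <->
  (forall i j,
    ((fun k => complex.Re (M k i j)) @ \oo --> complex.Re (L i j)) /\
    ((fun k => complex.Im (M k i j)) @ \oo --> complex.Im (L i j))).
Proof.
split.
- move=> /cvg_ballP H i j; split; apply/cvgrPdist_lt => e e0;
    have e0c : 0 < e%:C by [rewrite ltcR].
  + apply: filterS (H _ e0c) => k [_ /(_ i j)] Hk.
    rewrite -ltcR; apply: le_lt_trans Hk.
    by rewrite -raddfB normc_ge_Re.
  + apply: filterS (H _ e0c) => k [_ /(_ i j)] Hk.
    rewrite -ltcR; apply: le_lt_trans Hk.
    by rewrite -raddfB normc_ge_Im.
(* Positivity in [R[i]] forces the radius to be real. *)
- move=> H; apply/cvg_ballP => -[e e'] /[dup] e0; rewrite ltcE/= => /andP[/eqP -> er].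
  have H1 : forall ij : 'I_m * 'I_n, \forall k \near \oo,
     `|L ij.1 ij.2 - M k ij.1 ij.2| < e%:C.
    move=> [i j]/=; have [/cvgrPdist_lt hr /cvgrPdist_lt hi] := H i j.
    have e2 : 0 < e / 2 by rewrite divr_gt0.
    near=> k.
    apply: le_lt_trans (normc_le_ReIm _) _; rewrite ltcR [e]splitr ltrD//.
      by rewrite raddfB; near: k; exact: hr.
    by rewrite raddfB; near: k; exact: hi.
  apply: filterS (filter_forall _ H1) => k Hk; split=> [|i j]; first by rewrite ltcR.
  exact: Hk (i, j).
Unshelve. all: by end_near.
Qed.

Lemma cvg_sum (R : realType) (I : Type) (r : seq I) (f : I -> nat -> R) (l : I -> R) :
  (forall i, f i @ \oo --> l i) ->
  (fun k => \sum_(i <- r) f i k) @ \oo --> \sum_(i <- r) l i.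
Proof. by move=> H; apply: cvg_big => [x|i _]; [exact: add_continuous|exact: H]. Qed.

Lemma cvg_mulmx (R : realType) (m n p : nat)
    (M : nat -> ('M[R[i]]_(m, n) : normedModType R[i]))
    (M' : ('M[R[i]]_(m, n) : normedModType R[i]))
    (N : nat -> ('M[R[i]]_(n, p) : normedModType R[i]))
    (N' : ('M[R[i]]_(n, p) : normedModType R[i])) :
  M @ \oo --> M' -> N @ \oo --> N' ->
  (fun k => M k *m N k : ('M[R[i]]_(m, p) : normedModType R[i])) @ \oo
    --> (M' *m N' : ('M[R[i]]_(m, p) : normedModType R[i])).
Proof.
move=> /cvg_mxP HM /cvg_mxP HN; apply/cvg_mxP => i j.
have reE (A : 'M[R[i]]_(m, n)) (B : 'M[R[i]]_(n, p)) :
    complex.Re ((A *m B) i j) = \sum_l (complex.Re (A i l) * complex.Re (B l j)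
      - complex.Im (A i l) * complex.Im (B l j)).
  by rewrite mxE raddf_sum; apply: eq_bigr => l _; case: (A i l) => a a'; case: (B l j).
have imE (A : 'M[R[i]]_(m, n)) (B : 'M[R[i]]_(n, p)) :
    complex.Im ((A *m B) i j) = \sum_l (complex.Re (A i l) * complex.Im (B l j)
      + complex.Im (A i l) * complex.Re (B l j)).
  by rewrite mxE raddf_sum; apply: eq_bigr => l _; case: (A i l) => a a'; case: (B l j).
split.
- rewrite reE; under eq_fun do rewrite reE.
  apply: cvg_sum => l; have [? ?] := HM i l; have [? ?] := HN l j.
  by apply: cvgB; exact: cvgM.
- rewrite imE; under eq_fun do rewrite imE.
  apply: cvg_sum => l; have [? ?] := HM i l; have [? ?] := HN l j.
  by apply: cvgD; exact: cvgM.
Qed.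

(** The constant [c] adds up all entries of [A], so it bounds every row sum of moduli and each
    further factor [A] costs at most a factor [c]. *)
Lemma normr_expmx_le (R : realType) (n : nat) (A : 'M[R[i]]_n) :
  exists2 c : R, 0 <= c & forall k i j, `|(A ^+ k) i j| <= (c ^+ k)%:C.
Proof.
pose c : R := \sum_i \sum_j (`|complex.Re (A i j)| + `|complex.Im (A i j)|).
have c0 : 0 <= c by do 2!apply: sumr_ge0 => ? _; rewrite addr_ge0.
exists c => // k i j; elim: k i j => [|k IH] i j.
  by rewrite expr0 mxE; case: eqP; rewrite ?normr1 ?normr0 ?ler01.
rewrite exprS mxE (le_trans (ler_norm_sum _ _ _))//.
rewrite (@le_trans _ _ (\sum_l (`|complex.Re (A i l)| + `|complex.Im (A i l)|)%:C
    * (c ^+ k)%:C))//.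
  by apply: ler_sum => l _; rewrite normrM ler_pM// normc_le_ReIm.
rewrite -mulr_suml -rmorph_sum -rmorphM/= lecR exprS ler_wpM2r ?exprn_ge0//.
rewrite /c [leRHS](bigD1 i)//= lerDl.
by do 2!apply: sumr_ge0 => ? _; rewrite addr_ge0.
Qed.

(** As a [limn], [expmx] is meaningful only once the series converges; the scalar exponential series
    at [c] dominates every entry. *)
Lemma cvg_expmx (R : realType) (n : nat) (A : 'M[R[i]]_n) :
  series (fun k : nat => ((k`!)%:R)^-1 *: A ^+ k : CMat R n) @ \oo --> expmx A.
Proof.
set u := fun k => _.
have [c c0 Hc] := normr_expmx_le A.
have uc k i j : `|u k i j| <= (exp_coeff c k)%:C.
  rewrite /u mxE normrM normfV normr_nat mulrC /exp_coeff/=.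
  by rewrite [leRHS]rmorphM/= fmorphV/= rmorph_nat ler_wpM2r// invr_ge0.
have cvg_re i j : cvgn (series (fun k => complex.Re (u k i j))).
  apply: normed_cvg.
  apply: series_le_cvg (is_cvg_series_exp_coeff c) => k; first exact: normr_ge0.
    exact: exp_coeff_ge0.
  by rewrite -lecR (le_trans (normc_ge_Re _)).
have cvg_im i j : cvgn (series (fun k => complex.Im (u k i j))).
  apply: normed_cvg.
  apply: series_le_cvg (is_cvg_series_exp_coeff c) => k; first exact: normr_ge0.
    exact: exp_coeff_ge0.
  by rewrite -lecR (le_trans (normc_ge_Im _)).
apply/cvg_ex; exists (\matrix_(i, j) (limn (series (fun k => complex.Re (u k i j)))
   +i* limn (series (fun k => complex.Im (u k i j))))).
apply/cvg_mxP => i j; rewrite mxE/=; split.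
- apply: cvg_trans (cvg_re i j); apply: near_eq_cvg; apply: nearW => k.
  by rewrite /series/= summxE raddf_sum.
- apply: cvg_trans (cvg_im i j); apply: near_eq_cvg; apply: nearW => k.
  by rewrite /series/= summxE raddf_sum.
Qed.

Lemma expr_imaginary (R : realType) (x : R) (k : nat) :
  (k`!%:R)^-1 * ('i * x%:C) ^+ k = cos_coeff x k +i* sin_coeff x k.
Proof.
have -> : ('i * x%:C) ^+ k = ((~~ odd k)%:R * (-1) ^+ k./2 * x ^+ k)
    +i* ((odd k)%:R * (-1) ^+ k.-1./2 * x ^+ k) :> R[i].
  have -> : ('i * x%:C) ^+ k = 'i ^+ odd k * ((-1) ^+ k./2)%:C * (x ^+ k)%:C :> R[i].
    by rewrite exprMn -[in 'i ^+ k](odd_double_half k) exprD -mul2n exprM sqr_i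
      !rmorphXn/= rmorphN1.
  case: (boolP (odd k)) => ok.
    have -> : k.-1./2 = k./2.
      by case: k ok => //= k; move/negPf => ok; rewrite uphalf_half ok.
    by apply/eqP; rewrite eq_complex/=; apply/andP; split; apply/eqP; ring.
  by apply/eqP; rewrite eq_complex/=; apply/andP; split; apply/eqP; ring.
rewrite -[k`!%:R](rmorph_nat (real_complex R)) -fmorphV/=.
apply/eqP; rewrite eq_complex/= /cos_coeff /sin_coeff/=; apply/andP.
by split; apply/eqP; rewrite -?exprnP; ring.
Qed.

Definition expi (R : realType) (x : R) : R[i] := cos x +i* sin x.

(** Scalars are taken as 1 by 1 matrices so that [cvg_mxP] and [cvg_mulmx] apply to them. *)
Lemma cvg_expi (R : realType) (x : R) :
  (fun m => (\sum_(0 <= k < m) (k`!%:R)^-1 * ('i * x%:C) ^+ k)%:M :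
     ('M[R[i]]_1 : normedModType R[i])) @ \oo
  --> ((expi x)%:M : ('M[R[i]]_1 : normedModType R[i])).
Proof.
apply/cvg_mxP => i j; rewrite !ord1 mxE eqxx mulr1n /=; split.
- have H : series (cos_coeff x) @ \oo --> cos x.
    by rewrite unlock; exact: is_cvg_series_cos_coeff.
  apply: cvg_trans H.
  apply: near_eq_cvg; apply: nearW => m; rewrite mxE eqxx mulr1n raddf_sum.
  by apply: eq_bigr => k _; rewrite expr_imaginary.
- have H : series (sin_coeff x) @ \oo --> sin x.
    by rewrite unlock; exact: is_cvg_series_sin_coeff.
  apply: cvg_trans H.
  apply: near_eq_cvg; apply: nearW => m; rewrite mxE eqxx mulr1n raddf_sum.
  by apply: eq_bigr => k _; rewrite expr_imaginary.
Qed.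

(** On an eigenvector each partial sum acts as a scalar partial sum, so both sides are limits of the
    same sequence. *)
Lemma expmx_eigen (R : realType) (n : nat) (A : 'M[R[i]]_n) (v : 'cV[R[i]]_n) (x : R) :
  A *m v = ('i * x%:C) *: v -> expmx A *m v = expi x *: v.
Proof.
move=> Av.
have Akv k : A ^+ k *m v = ('i * x%:C) ^+ k *: v.
  elim: k => [|k IH]; first by rewrite !expr0 mul1mx scale1r.
  by rewrite exprSr -mulmxA Av -scalemxAr IH scalerA -exprS.
have h1 := cvg_mulmx (@cvg_expmx R n A) (cvg_cst (v : ('cV[R[i]]_n : normedModType R[i]))).
have h2 := cvg_mulmx (cvg_cst (v : ('cV[R[i]]_n : normedModType R[i]))) (@cvg_expi R x).
rewrite mul_mx_scalar in h2.
apply: (cvg_unique (@norm_hausdorff _ ('cV[R[i]]_n : normedModType R[i])) (h1 _)).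
apply: cvg_trans (h2 _); apply: near_eq_cvg; apply: nearW => m.
rewrite mul_mx_scalar /series/= mulmx_suml scaler_suml.
by apply: eq_bigr => k _; rewrite -scalemxAl Akv scalerA.
Qed.

Lemma expmx_eigen_row (R : realType) (n : nat) (A : 'M[R[i]]_n) (v : 'rV[R[i]]_n) (x : R) :
  v *m A = ('i * x%:C) *: v -> v *m expmx A = expi x *: v.
Proof.
move=> Av.
have Akv k : v *m A ^+ k = ('i * x%:C) ^+ k *: v.
  elim: k => [|k IH]; first by rewrite !expr0 mulmx1 scale1r.
  by rewrite exprS mulmxA Av -scalemxAl IH scalerA -exprS.
have h1 := cvg_mulmx (cvg_cst (v : ('rV[R[i]]_n : normedModType R[i]))) (@cvg_expmx R n A).
have h2 := cvg_mulmx (@cvg_expi R x) (cvg_cst (v : ('rV[R[i]]_n : normedModType R[i]))).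
rewrite mul_scalar_mx in h2.
apply: (cvg_unique (@norm_hausdorff _ ('rV[R[i]]_n : normedModType R[i])) (h1 _)).
apply: cvg_trans (h2 _); apply: near_eq_cvg; apply: nearW => m.
rewrite mul_scalar_mx /series/= mulmx_sumr scaler_suml.
by apply: eq_bigr => k _; rewrite -scalemxAr Akv scalerA.
Qed.

(** * Laplacian eigenfunctions and state transfer *)

(** The Laplacian is written as a sum of differences over neighbours, free of degrees and of the
    enumeration of the vertices. *)
Definition eigenfun (R : realType) (V : finType) (adj : rel V) (mu : R) (f : V -> R) :=
  forall v, \sum_w (adj v w)%:R * (f v - f w) = mu * f v.

Definition colfun (R : realType) (V : finType) (f : V -> R) : 'cV[R[i]]_#|V| :=
  \col_j (f (enum_val j))%:C.

Lemma laplacian_colfun (R : realType) (V : finType) (adj : rel V) (mu : R) (f : V -> R) :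
  eigenfun adj mu f -> laplacian R[i] adj *m colfun f = mu%:C *: colfun f.
Proof.
move=> Hf; apply/matrixP => i j; rewrite {j}ord1 !mxE.
rewrite (reindex (@enum_rank V)); last by apply: onW_bij; exact: enum_rank_bij.
rewrite -rmorphM -Hf rmorph_sum/=.
under eq_bigr do rewrite !mxE enum_rankK mulrBl.
under [RHS]eq_bigr do rewrite mulrBr rmorphB !rmorphM/= rmorph_nat.
rewrite !sumrB; congr (_ - _).
rewrite (bigD1 (enum_val i))//= eqxx big1 ?addr0; last first.
  by move=> w; rewrite eq_sym => /negbTE ->; rewrite mul0r.
rewrite -mulr_suml; congr (_ * _); rewrite -sum1_card natr_sum.
rewrite [LHS]big_mkcond/=; apply: eq_bigr => w _.
by case: (boolP (adj _ w)) => h; [rewrite mem_set|rewrite memNset//; exact/negP].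
Qed.

Lemma laplacian_rowfun (R : realType) (V : finType) (adj : rel V) (mu : R) (f : V -> R) :
  symmetric adj -> eigenfun adj mu f ->
  (colfun f)^T *m laplacian R[i] adj = mu%:C *: (colfun f)^T.
Proof.
move=> adjC /laplacian_colfun Hf; rewrite -linearZ/= -Hf trmx_mul; congr (_ *m _).
apply/matrixP => i j; rewrite !mxE adjC eq_sym; case: eqP => [->|_]//.
Qed.

(* Pairing with the constant eigenfunction forces the phase [gamma] to be 1. *)
Lemma LPGST_eigenfun (R : realType) (V : finType) (adj : rel V) (a b : V) :
  symmetric adj -> LPGST R adj a b ->
  exists t : nat -> R, forall mu (f : V -> R), eigenfun adj mu f -> f a != 0 ->
    (fun k => cos (t k * mu)) @ \oo --> f b / f a /\
    (fun k => sin (t k * mu)) @ \oo --> (0 : R).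
Proof.
move=> adjC [t [g Hg]]; exists t.
(* Pairing the evolving state with the row eigenvector of [f] turns the matrix exponential into the
   scalar [expi (t k * mu)]. *)
have key mu (f : V -> R) : eigenfun adj mu f ->
    (fun k => cos (t k * mu) * f a) @ \oo --> complex.Re g * f b /\
    (fun k => sin (t k * mu) * f a) @ \oo --> complex.Im g * f b.
  move=> /(laplacian_rowfun adjC) Hf.
  have := cvg_mulmx (cvg_cst ((colfun f)^T : ('rV[R[i]]_#|V| : normedModType R[i]))) Hg.
  move=> /(_ _)/cvg_mxP/(_ 0 0).
  have -> : ((colfun f)^T *m (g *: evec R (enum_rank b))) 0 0 = g * (f b)%:C.
    by rewrite -scalemxAr mxE -colE !mxE enum_rankK.
  have E k : (colfun f)^T *m expmx (('i * (t k)%:C) *: laplacian R[i] adj)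
      = expi (t k * mu) *: (colfun f)^T.
    by apply: expmx_eigen_row; rewrite -scalemxAr Hf scalerA rmorphM mulrA.
  move=> [hr hi]; split; [move: hr|move: hi].
  - have -> : complex.Re (g * (f b)%:C) = complex.Re g * f b.
      by case: (g) => x y; rewrite /= mulr0 subr0.
    apply: cvg_trans; apply: near_eq_cvg; apply: nearW => k.
    by rewrite mulmxA E -scalemxAl mxE -colE !mxE enum_rankK/= mulr0 subr0.
  - have -> : complex.Im (g * (f b)%:C) = complex.Im g * f b.
      by case: (g) => x y; rewrite /= mulr0 add0r.
    apply: cvg_trans; apply: near_eq_cvg; apply: nearW => k.
    by rewrite mulmxA E -scalemxAl mxE -colE !mxE enum_rankK/= mulr0 add0r.
have [re_g im_g] : complex.Re g = 1 /\ complex.Im g = 0.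
  have [|h1 h2] := key 0 (fun=> 1).
    by move=> v; rewrite big1 ?mul0r// => w _; rewrite subrr mulr0.
  rewrite mulr1 in h1; rewrite mulr1 in h2; split.
  - apply: (cvg_unique (@norm_hausdorff _ R) h1).
    rewrite /mkset (_ : (fun k => _) = cst (1 : R)); last by apply/funext => k; rewrite mulr0 cos0 mulr1.
    exact: cvg_cst.
  - apply: (cvg_unique (@norm_hausdorff _ R) h2).
    rewrite /mkset (_ : (fun k => _) = cst (0 : R)); last by apply/funext => k; rewrite mulr0 sin0 mul0r.
    exact: cvg_cst.
move=> mu f Hf fa; have [] := key mu f Hf.
rewrite re_g im_g mul1r mul0r => h1 h2; split.
- under eq_fun do rewrite -[cos _](mulfK fa).
  by apply: cvgM => //; exact: cvg_cst.
- under eq_fun do rewrite -[sin _](mulfK fa).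
  by rewrite -(mul0r (f a)^-1); apply: cvgM => //; exact: cvg_cst.
Qed.

(** Converse direction: the [f j] are eigencomponents of the indicator of [a], and replacing each
    phase by its limit [s j] recombines them into the indicator of [b]. *)
Lemma eigenfun_LPGST (R : realType) (V : finType) (adj : rel V) (a b : V)
    (I : finType) (f : I -> V -> R) (mu s : I -> R) (t : nat -> R) :
  (forall j, eigenfun adj (mu j) (f j)) ->
  (forall v, \sum_j f j v = (v == a)%:R) ->
  (forall v, \sum_j s j * f j v = (v == b)%:R) ->
  (forall j, (fun k => cos (t k * mu j)) @ \oo --> s j) ->
  (forall j, (fun k => sin (t k * mu j)) @ \oo --> (0 : R)) ->
  LPGST R adj a b.
Proof.
move=> Hf Ha Hb Hc Hs; exists t, 1; rewrite scale1r.
have evecE (c : V) (u : I -> R) : (forall v, \sum_j u j * f j v = (v == c)%:R) ->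
    evec R (enum_rank c) = \sum_j (u j)%:C *: colfun (f j).
  move=> Hu; apply/matrixP => i j; rewrite !ord1 !mxE summxE eqxx andbT.
  under eq_bigr do rewrite !mxE -rmorphM.
  rewrite -rmorph_sum/= Hu rmorph_nat; congr (nat_of_bool _)%:R.
  by rewrite -(inj_eq enum_val_inj) enum_rankK.
have Ht k : expmx (('i * (t k)%:C) *: laplacian R[i] adj) *m evec R (enum_rank a)
    = \sum_j expi (t k * mu j) *: colfun (f j).
  rewrite (@evecE a (fun=> 1)); last by move=> v; under eq_bigr do rewrite mul1r.
  rewrite mulmx_sumr; apply: eq_bigr => j _; rewrite scale1r.
  by apply: expmx_eigen; rewrite -scalemxAl (laplacian_colfun (Hf j)) scalerA rmorphM mulrA.
under eq_fun do rewrite Ht.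
rewrite (evecE b s Hb); apply/cvg_mxP => i j; rewrite !ord1 summxE !raddf_sum/=.
split.
- under eq_fun do rewrite summxE raddf_sum.
  apply: cvg_sum => l.
  rewrite !mxE/= mulr0 subr0; under eq_fun do rewrite !mxE/= mulr0 subr0.
  by apply: cvgM; [exact: Hc|exact: cvg_cst].
- under eq_fun do rewrite summxE raddf_sum.
  apply: cvg_sum => l.
  rewrite !mxE/= mulr0 mul0r addr0; under eq_fun do rewrite !mxE/= mulr0 add0r.
  by rewrite -(mul0r (f l (enum_val i))); apply: cvgM; [exact: Hs|exact: cvg_cst].
Qed.

(** * Eigenfunctions of the blow-up *)

Lemma sum_option (R : realType) (I : finType) (F : option I -> R) :
  \sum_j F j = F None + \sum_i F (Some i).
Proof.
rewrite (bigD1 None)//=; congr (_ + _).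
rewrite (reindex_omap Some id); last by case.
by apply: eq_bigl => i /=; rewrite eqxx.
Qed.

Lemma sum_blowup2 (R : realType) (V : finType) (F : 'I_2 * V -> R) :
  \sum_w F w = \sum_v (F (ord0, v) + F (ord_max, v)).
Proof.
transitivity (\sum_w F (w.1, w.2)); first by apply: eq_bigr => -[].
rewrite -(pair_bigA _ (fun i v => F (i, v)))/= !big_ord_recl big_ord0 addr0 -big_split.
by apply: eq_bigr => v _; congr (_ + F (_, _)); apply/val_inj.
Qed.

Lemma eigenfun_blowup2 (R : realType) (V : finType) (adj : rel V) (mu : R) (f : V -> R) :
  eigenfun adj mu f -> eigenfun (blowup2 adj) (2 * mu) (fun x => f x.2).
Proof.
move=> Hf [i v]; rewrite sum_blowup2 /blowup2/= -mulrA -Hf mulr_sumr.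
by apply: eq_bigr => w _; ring.
Qed.

(** The values at the two copies of a neighbour cancel, so only the degree term of the Laplacian
    survives. *)
Lemma eigenfun_blowup2_sign (R : realType) (V : finType) (adj : rel V) (v : V) (d : R) :
  \sum_w (adj v w)%:R = d ->
  eigenfun (blowup2 adj) (2 * d) (fun x => (-1) ^+ x.1 * (x.2 == v)%:R).
Proof.
move=> Hd [i u]; rewrite sum_blowup2 /blowup2/=.
transitivity (\sum_w (adj u w)%:R * (2 * ((-1) ^+ i * (u == v)%:R)) : R).
  by apply: eq_bigr => w _; rewrite expr0 expr1; ring.
rewrite -mulr_suml; case: eqP => [->|_]; last by rewrite !mulr0.
by rewrite Hd; ring.
Qed.

Lemma LPGST_blowup2 (R : realType) (V : finType) (adj : rel V) (v : V) (d : R) :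
  symmetric adj -> \sum_w (adj v w)%:R = d ->
  LPGST R (blowup2 adj) (ord0, v) (ord_max, v) ->
  exists t : nat -> R,
    (forall mu (f : V -> R), eigenfun adj mu f -> f v != 0 ->
      (fun k => cos (t k * mu)) @ \oo --> (1 : R) /\
      (fun k => sin (t k * mu)) @ \oo --> (0 : R)) /\
    (fun k => cos (t k * d)) @ \oo --> (-1 : R) /\
    (fun k => sin (t k * d)) @ \oo --> (0 : R).
Proof.
move=> adjC Hd /LPGST_eigenfun[|t Ht]; first by move=> x y; exact: adjC.
(* Doubling the times absorbs the factor 2 in the eigenvalues of the blow-up. *)
exists (fun k => t k * 2); split=> [mu f Hf fv|].
  have := Ht _ _ (eigenfun_blowup2 Hf) fv; rewrite /= divff// => -[h1 h2].
  split; [move: h1|move: h2]; by under eq_fun do rewrite mulrA.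
have := Ht _ _ (eigenfun_blowup2_sign Hd).
rewrite /= eqxx expr0 expr1 !mulr1 divr1 => /(_ (oner_neq0 _)) [h1 h2].
split; [move: h1|move: h2]; by under eq_fun do rewrite mulrA.
Qed.

Lemma blowup2_LPGST (R : realType) (V : finType) (adj : rel V) (v : V) (d : R)
    (I : finType) (f : I -> V -> R) (mu : I -> R) (t : nat -> R) :
  \sum_w (adj v w)%:R = d ->
  (forall j, eigenfun adj (mu j) (f j)) ->
  (forall u, \sum_j f j u = (u == v)%:R) ->
  (forall j, (fun k => cos (t k * mu j)) @ \oo --> (1 : R)) ->
  (forall j, (fun k => sin (t k * mu j)) @ \oo --> (0 : R)) ->
  (fun k => cos (t k * d)) @ \oo --> (-1 : R) ->
  (fun k => sin (t k * d)) @ \oo --> (0 : R) ->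
  LPGST R (blowup2 adj) (ord0, v) (ord_max, v).
Proof.
move=> Hd Hf Hv Hc Hs Hcd Hsd.
have eigZ (W : finType) (a : rel W) (m c : R) g :
    eigenfun a m g -> eigenfun a m (fun x => c * g x).
  move=> Hg x; rewrite mulrCA -Hg mulr_sumr; apply: eq_bigr => w _; ring.
(* [None] indexes the signed function. Half the lift of the indicator of [v], plus or minus half the
   signed function, is the indicator of one copy of [v]. *)
pose F (j : option I) (x : 'I_2 * V) : R :=
  2^-1 * if j is Some i then f i x.2 else (-1) ^+ x.1 * (x.2 == v)%:R.
pose mu' (j : option I) : R := 2 * if j is Some i then mu i else d.
pose s (j : option I) : R := if j is Some i then 1 else -1.
apply: (@eigenfun_LPGST R _ (blowup2 adj) _ _ _ F mu' s (fun k => t k / 2));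
  rewrite /F /mu' /s.
- case=> [i|]; apply: eigZ; first exact: eigenfun_blowup2.
  exact: eigenfun_blowup2_sign.
- move=> [i u]; rewrite sum_option/= -!mulr_sumr Hv xpair_eqE.
  by case: i => -[|[|//]] hi /=; rewrite ?expr0 ?expr1; case: eqP => _ /=; field.
- move=> [i u]; rewrite sum_option/=.
  under eq_bigr do rewrite mul1r.
  rewrite -!mulr_sumr Hv xpair_eqE.
  by case: i => -[|[|//]] hi /=; rewrite ?expr0 ?expr1; case: eqP => _ /=; field.
- have E k (x : R) : t k / 2 * (2 * x) = t k * x by field.
  by case=> [i|]; under eq_fun do rewrite E; [exact: Hc|exact: Hcd].
- have E k (x : R) : t k / 2 * (2 * x) = t k * x by field.
  by case=> [i|]; under eq_fun do rewrite E; [exact: Hs|exact: Hsd].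
Qed.

(** * Eigenfunctions of the double star *)

Lemma dstar_adjC (k l : nat) : symmetric (@dstar_adj k l).
Proof. by move=> i j; rewrite /dstar_adj orbC. Qed.

(** Taking [G] on [nat] lets the vertex sum be cut at 2 and [k + 2] into the two centres and the two
    classes of leaves. *)
Lemma sum_dstar_adj (R : realType) (k l : nat) (v : 'I_(k + l + 2)) (G : nat -> R) :
  \sum_w (dstar_adj v w)%:R * G w =
    if v == 0%N :> nat then G 1%N + \sum_(2 <= i < k + 2) G i
    else if v == 1%N :> nat then G 0%N + \sum_(k + 2 <= i < k + l + 2) G i
    else if (v < k + 2)%N then G 0%N else G 1%N.
Proof.
case: v => v hv /=.
pose A (i j : nat) : bool := [|| (i == 0) && (j == 1),
  (i == 0) && (2 <= j < k + 2) | (i == 1) && (k + 2 <= j)]%N.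
rewrite /dstar_adj /dstar_adj0 /=.
rewrite -(big_mkord xpredT (fun w => (A v w || A w v)%:R * G w)).
rewrite (big_cat_nat (n := 2)) ?leq_addl//= (big_cat_nat (n := k + 2) (m := 2));
  [|lia|lia].
rewrite !big_nat_recl// big_geq// addr0.
have const a b (c : bool) : (forall i, (a <= i < b)%N -> (A v i || A i v) = c) ->
    \sum_(a <= i < b) (A v i || A i v)%:R * G i = c%:R * \sum_(a <= i < b) G i.
  by move=> H; rewrite mulr_sumr; apply: eq_big_nat => i /H ->.
case: v hv const => [|[|v]] hv const.
- rewrite (const _ _ true) ?(const _ _ false); rewrite /A; [|lia|lia].
  by rewrite !addn2 /= !mul1r !mul0r addr0 add0r.
- rewrite (const _ _ false) ?(const _ _ true); rewrite /A; [|lia|lia].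
  by rewrite !addn2 /= !mul1r !mul0r addr0 add0r.
- rewrite (const _ _ false) ?(const _ _ false); rewrite /A; [|lia|lia].
  rewrite !addn2 /= !mul0r !addr0 orbF.
  have -> : (k.+1 < v.+2)%N = ~~ (v.+2 < k.+2)%N by rewrite -leqNgt.
  by case: ifP => _ /=; rewrite mul1r mul0r ?addr0 ?add0r.
Qed.

(** Functions constant on the cells of the equitable partition into two centres and two classes of
    leaves; the Laplacian preserves their space. *)
Definition dstar_fun (R : realType) (k : nat) (x y u w : R) (i : nat) : R :=
  if i == 0%N then x else if i == 1%N then y else if (i < k + 2)%N then u else w.

Lemma eigenfun_dstar (R : realType) (k l : nat) (mu x y u w : R) :
  x - y + k%:R * (x - u) = mu * x -> y - x + l%:R * (y - w) = mu * y ->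
  u - x = mu * u -> w - y = mu * w ->
  eigenfun (@dstar_adj k l) mu (fun i => dstar_fun k x y u w i).
Proof.
move=> h0 h1 hu hw v.
rewrite (sum_dstar_adj v (fun i => dstar_fun k x y u w v - dstar_fun k x y u w i)).
have hub : \sum_(2 <= i < k + 2) (x - dstar_fun k x y u w i) = k%:R * (x - u).
  transitivity (\sum_(2 <= i < k + 2) (x - u)).
    apply: eq_big_nat => i /andP[i2 ik]; rewrite /dstar_fun ik.
    by case: i i2 {ik} => [|[|i]].
  by rewrite sumr_const_nat addnK mulr_natl.
have leaf : \sum_(k + 2 <= i < k + l + 2) (y - dstar_fun k x y u w i) = l%:R * (y - w).
  transitivity (\sum_(k + 2 <= i < k + l + 2) (y - w)).
    apply: eq_big_nat => i /andP[ik _]; rewrite /dstar_fun [(i < _)%N]ltnNge ik.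
    by case: i ik => [|[|i]]; rewrite addn2.
  by rewrite sumr_const_nat addnAC addKn mulr_natl.
case: eqP => [->|v0]; first by rewrite -hub in h0; exact: h0.
case: eqP => [->|v1]; first by rewrite -leaf in h1; exact: h1.
rewrite [dstar_fun k x y u w v]/dstar_fun; have /negbTE -> := introN eqP v0.
have /negbTE -> := introN eqP v1.
by case: (v < k + 2)%N; [exact: hu|exact: hw].
Qed.

(** The function sums to 0 over the leaves at the second centre, so that centre does not feel it.
    Its value [l - 1] at [j] is nonzero exactly when [l] is not 1. *)
Lemma eigenfun_dstar_leaf (R : realType) (k l j : nat) :
  (k + 2 <= j < k + l + 2)%N ->
  eigenfun (@dstar_adj k l) 1
    (fun i => if (k + 2 <= i)%N then l%:R * (i == j :> nat)%:R - 1 else 0 : R).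
Proof.
move=> hj v.
pose f (i : nat) : R := if (k + 2 <= i)%N then l%:R * (i == j)%:R - 1 else 0.
rewrite (sum_dstar_adj v (fun i => f v - f i)) -/(f v).
have f_lt i : (i < k + 2)%N -> f i = 0 by move=> hi; rewrite /f leqNgt hi.
have f0 : f 0%N = 0 by apply: f_lt; lia.
have f1 : f 1%N = 0 by apply: f_lt; lia.
rewrite f0 f1 !subr0 mul1r; case: eqP => [->|v0].
  rewrite f0 add0r big_nat_cond big1// => i /andP[/andP[_ hi] _].
  by rewrite f_lt// subrr.
case: eqP => [->|v1].
  rewrite f1 add0r; under eq_bigr do rewrite sub0r.
  rewrite sumrN; apply/eqP; rewrite oppr_eq0.
  rewrite (eq_big_nat _ _ (F2 := fun i => l%:R * (i == j)%:R - 1)); last first.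
    by move=> i /andP[hi _]; rewrite /f hi.
  rewrite sumrB sumr_const_nat -mulr_sumr (bigD1_seq j)/= ?mem_index_iota ?iota_uniq//.
  rewrite eqxx big1 ?addr0 ?mulr1; last by move=> i /negbTE ->.
  by rewrite subr_eq0; apply/eqP; congr _%:R; lia.
by case: ifP.
Qed.

Lemma sum_dstar_adj_hub (R : realType) (k l : nat) (v : 'I_(k + l + 2)) :
  v = 0%N :> nat -> \sum_w (dstar_adj v w)%:R = k.+1%:R :> R.
Proof.
move=> v0; have := sum_dstar_adj v (fun=> 1 : R).
under eq_bigr do rewrite mulr1; move=> ->.
by rewrite v0 /= sumr_const_nat addnK -natr1 addrC.
Qed.

Lemma sum_dstar_adj_leaf (R : realType) (k l : nat) (v : 'I_(k + l + 2)) :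
  (k + 2 <= v)%N -> \sum_w (dstar_adj v w)%:R = 1 :> R.
Proof.
move=> hv; have := sum_dstar_adj v (fun=> 1 : R).
under eq_bigr do rewrite mulr1; move=> ->.
by rewrite !ifF//; lia.
Qed.

(** The polynomial p with [a = k + 1] and [b = l + 1], over any ring so that it can be moved between
    [int], [rat], [R] and polynomials. *)
Definition cubic (R : pzRingType) (a b x : R) : R :=
  x * (x - a) * (x - b) - (x - 1) * (x - a) - (x - 1) * (x - b).

(** Normalised to 1 on the leaves of the first centre; the equations at these leaves, at the first
    centre and at the second centre then determine the other three values in turn. *)
Definition dstar_eigen (R : realType) (k l : nat) (x : R) : nat -> R :=
  let y := (k.+1%:R - x) * (1 - x) - k%:R in
  dstar_fun k (1 - x) y 1 (((l.+1%:R - x) * y - (1 - x)) / l%:R).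

Lemma eigenfun_dstar_eigen (R : realType) (k l : nat) (x c : R) : (0 < l)%N ->
  x * cubic k.+1%:R l.+1%:R x = 0 ->
  eigenfun (@dstar_adj k l) x (fun i => c * dstar_eigen k l x i).
Proof.
move=> l0; rewrite /cubic -!natr1 => hx.
have lN0 : l%:R != 0 :> R by rewrite pnatr_eq0 -lt0n.
pose y := (k.+1%:R - x) * (1 - x) - k%:R.
have H := @eigenfun_dstar R k l x (c * (1 - x)) (c * y) c
  (c * (((l.+1%:R - x) * y - (1 - x)) / l%:R)).
have E i : c * dstar_eigen k l x i = dstar_fun k (c * (1 - x)) (c * y) c
  (c * (((l.+1%:R - x) * y - (1 - x)) / l%:R)) i.
  by rewrite /dstar_eigen /dstar_fun/=; do !case: ifP => // _; rewrite mulr1.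
have {}H : eigenfun (@dstar_adj k l) x (fun i => dstar_fun k (c * (1 - x)) (c * y) c
  (c * (((l.+1%:R - x) * y - (1 - x)) / l%:R)) i).
  apply: H; rewrite /y -?natr1 -?natr1.
  - ring.
  - by field.
  - ring.
  (* The first three equations hold by construction; the one at the last class of leaves amounts to
     the vanishing of x p(x). *)
  - apply: (mulfI lN0); apply/eqP; rewrite -subr_eq0; apply/eqP.
    transitivity (c * (x * ((x * (x - (k%:R + 1)) * (x - (l%:R + 1)) -
      (x - 1) * (x - (k%:R + 1)) - (x - 1) * (x - (l%:R + 1)))))).
      by field.
    by rewrite hx mulr0.
by move=> v; rewrite E -H; apply: eq_bigr => w _; rewrite E.
Qed.

Lemma cubic1 (R : realType) (k l : nat) :
  cubic k.+1%:R l.+1%:R 1 = k%:R * l%:R :> R.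
Proof. by rewrite /cubic -!natr1; ring. Qed.

Lemma root_cubic_neq1 (R : realType) (k l : nat) (x : R) : (0 < k)%N -> (0 < l)%N ->
  x * cubic k.+1%:R l.+1%:R x = 0 -> x != 1.
Proof.
move=> k0 l0; apply: contra_eq_neq => ->.
by rewrite cubic1 mul1r mulf_neq0// pnatr_eq0 -lt0n.
Qed.

(** If the leaf value vanished, the leaf equation would make its centre vanish, and the equation at
    that centre would then give [1 - x = 0]. *)
Lemma dstar_eigen_leaf_neq0 (R : realType) (k l i : nat) (x : R) :
  (0 < k)%N -> (0 < l)%N -> (k + 2 <= i)%N ->
  x * cubic k.+1%:R l.+1%:R x = 0 -> dstar_eigen k l x i != 0.
Proof.
move=> k0 l0 hi hx; have x1 := root_cubic_neq1 k0 l0 hx.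
have lN0 : l%:R != 0 :> R by rewrite pnatr_eq0 -lt0n.
rewrite /dstar_eigen /dstar_fun !ifF; [|lia..].
apply/eqP => /(congr1 (fun z => z * l%:R)); rewrite mul0r divfK//.
move: hx; rewrite /cubic -!natr1 => hx.
set y := (X in _ * X - (1 - x)) => hy.
have y0 : y = 0.
  apply: (mulfI lN0); rewrite mulr0.
  transitivity ((1 - x) * ((l%:R + 1 - x) * y - (1 - x)) - x * (x * (x - (k%:R + 1)) *
    (x - (l%:R + 1)) - (x - 1) * (x - (k%:R + 1)) - (x - 1) * (x - (l%:R + 1)))).
    by rewrite /y; ring.
  by rewrite hy hx mulr0 subr0.
move/eqP: hy; rewrite y0 mulr0 sub0r oppr_eq0 subr_eq0 eq_sym.
by rewrite (negbTE x1).
Qed.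

(** The Vandermonde matrix of distinct nodes is invertible. *)
Lemma moment_problem (F : fieldType) (n : nat) (x m : 'I_n -> F) :
  injective x -> exists c : 'I_n -> F, forall i : 'I_n, \sum_j c j * x j ^+ i = m i.
Proof.
move=> xI; pose V : 'M[F]_n := Vandermonde n (\row_j x j).
have Vu : V \in unitmx.
  rewrite unitmxE unitfE det_Vandermonde; apply/prodf_neq0 => i _.
  apply/prodf_neq0 => j ij; rewrite !mxE subr_eq0; apply: contraTneq ij => /xI ->.
  by rewrite ltnn.
exists (fun j => (invmx V *m (\col_i m i)) j 0) => i.
have := congr1 (fun M : 'cV[F]_n => M i 0) (mulKVmx Vu (\col_i m i)).
by rewrite !mxE => <-; apply: eq_bigr => j _; rewrite !mxE mulrC.
Qed.

(** The four values of [dstar_eigen] are polynomials of degrees 0, 1, 2, 3 in the eigenvalue, so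
    prescribing a combination of them amounts to prescribing the moments of [c]. The numbers [m1],
    [m2], [m3] solve this triangular system. *)
Lemma dstar_eigen_span (R : realType) (k l : nat) (lam : 'I_4 -> R) (x y u w : R) :
  (0 < l)%N -> injective lam ->
  exists c : 'I_4 -> R,
    forall i, \sum_j c j * dstar_eigen k l (lam j) i = dstar_fun k x y u w i.
Proof.
move=> l0 lamI; have lN0 : l%:R != 0 :> R by rewrite pnatr_eq0 -lt0n.
pose m1 : R := u - x; pose m2 : R := y + (k%:R + 2) * m1 - u.
pose m3 : R := (k%:R + 2) * m2 - m1 + (l%:R + 1) * y - l%:R * w - x.
have [c Hc] := moment_problem (fun i : 'I_4 => [:: u; m1; m2; m3]`_i) lamI.
have c0 : \sum_j c j = u.
  by rewrite -[RHS](Hc ord0); apply: eq_bigr => j _; rewrite mulr1.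
have c1 : \sum_j c j * lam j = m1 by have := Hc (inord 1); rewrite inordK.
have c2 : \sum_j c j * lam j ^+ 2 = m2 by have := Hc (inord 2); rewrite inordK.
have c3 : \sum_j c j * lam j ^+ 3 = m3 by have := Hc (inord 3); rewrite inordK.
have lin (p0 p1 p2 p3 : R) :
    \sum_j c j * (p0 + p1 * lam j + p2 * lam j ^+ 2 + p3 * lam j ^+ 3)
    = p0 * u + p1 * m1 + p2 * m2 + p3 * m3.
  rewrite -c0 -c1 -c2 -c3 !mulr_sumr -!big_split/=.
  by apply: eq_bigr => j _; ring.
exists c => i; rewrite /dstar_eigen /dstar_fun.
case: ifP => _.
  transitivity (1 * u + -1 * m1 + 0 * m2 + 0 * m3); last by rewrite /m1; ring.
  by rewrite -lin; apply: eq_bigr => j _; ring.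
case: ifP => _.
  transitivity (1 * u + - (k%:R + 2) * m1 + 1 * m2 + 0 * m3); last by rewrite /m2; ring.
  by rewrite -lin; apply: eq_bigr => j _; rewrite -?natr1 -?natr1; ring.
case: ifP => _.
  by rewrite -[RHS]c0; apply: eq_bigr => j _; rewrite mulr1.
transitivity ((l%:R / l%:R) * u + (- (1 + (l%:R + 1) * (k%:R + 2) - 1) / l%:R) * m1
  + ((l%:R + 1) + (k%:R + 2)) / l%:R * m2 + - l%:R^-1 * m3); last first.
  by rewrite /m3 /m2 /m1; field.
by rewrite -lin; apply: eq_bigr => j _; rewrite -?natr1 -?natr1; field.
Qed.

(** * The roots of the cubic *)

Lemma cubicC (R : comPzRingType) (a b x : R) : cubic a b x = cubic b a x.
Proof. by rewrite /cubic; ring. Qed.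

Lemma rmorph_cubic (R S : pzRingType) (f : {rmorphism R -> S}) (a b x : R) :
  f (cubic a b x) = cubic (f a) (f b) (f x).
Proof. by rewrite /cubic !rmorphB !rmorphM !rmorphB rmorph1. Qed.

Lemma cubic_ivt (R : rcfType) (a b u v : R) : u <= v ->
  cubic a b u * cubic a b v < 0 -> exists2 x, u < x < v & cubic a b x = 0.
Proof.
move=> uv; pose P : {poly R} := cubic a%:P b%:P 'X.
have PE x : P.[x] = cubic a b x by rewrite /P /cubic !hornerE.
rewrite -!PE => /(polyrcf.poly_ivtoo uv)[x]; rewrite in_itv/= => xuv rx.
by exists x => //; rewrite -PE; exact/rootP.
Qed.

(** The signs at 0, 1, [b + 1] and [b + 2] alternate, starting with a negative value. *)
Lemma cubic_roots_le (R : rcfType) (a b : R) : 2 <= a -> a <= b ->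
  exists l1 l2 l3 : R,
    [/\ 0 < l1 < 1, 1 < l2 < b + 1, b + 1 < l3 < b + 2 &
        [/\ cubic a b l1 = 0, cubic a b l2 = 0 & cubic a b l3 = 0]].
Proof.
move=> a2 ab.
have p0 : cubic a b 0 < 0 by rewrite /cubic; nra.
have p1 : 0 < cubic a b 1.
  by rewrite (_ : cubic a b 1 = (a - 1) * (b - 1)); [nra|rewrite /cubic; ring].
have p2 : cubic a b (b + 1) < 0.
  by rewrite (_ : cubic a b (b + 1) = 1 - a); [lra|rewrite /cubic; ring].
have p3 : 0 < cubic a b (b + 2).
  rewrite (_ : cubic a b (b + 2) = b * (b - a) + 3 * (b - a) + 4); first by nra.
  by rewrite /cubic; ring.
have [l1 h1 r1] : exists2 x, 0 < x < 1 & cubic a b x = 0.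
  by apply: cubic_ivt; [lra|rewrite pmulr_llt0].
have [l2 h2 r2] : exists2 x, 1 < x < b + 1 & cubic a b x = 0.
  by apply: cubic_ivt; [lra|rewrite pmulr_rlt0].
have [l3 h3 r3] : exists2 x, b + 1 < x < b + 2 & cubic a b x = 0.
  by apply: cubic_ivt; [lra|rewrite pmulr_llt0].
by exists l1, l2, l3.
Qed.

(** Vieta's relation without factoring: an alternating combination of the three values is the
    Vandermonde product times the difference of the two sides. *)
Lemma cubic_roots_sum (F : fieldType) (a b x y z : F) :
  x != y -> y != z -> x != z ->
  cubic a b x = 0 -> cubic a b y = 0 -> cubic a b z = 0 -> x + y + z = a + b + 2.
Proof.
rewrite -!(subr_eq0 x) -!(subr_eq0 y) => xy yz xz hx hy hz.
apply: (mulfI xy); apply: (mulfI yz); apply: (mulfI xz).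
apply/eqP; rewrite -subr_eq0; apply/eqP.
transitivity ((y - z) * cubic a b x - (x - z) * cubic a b y + (x - y) * cubic a b z).
  by rewrite /cubic; ring.
by rewrite hx hy hz !mulr0 subr0 addr0.
Qed.

(** If [t] differs from [x] and [y], the triples [t, x, y] and [x, y, z] have the same sum. *)
Lemma cubic_root_cases (F : fieldType) (a b x y z t : F) :
  x != y -> y != z -> x != z ->
  cubic a b x = 0 -> cubic a b y = 0 -> cubic a b z = 0 -> cubic a b t = 0 ->
  [\/ t = x, t = y | t = z].
Proof.
move=> xy yz xz hx hy hz ht.
have [->|tx] := eqVneq t x; first exact: Or31.
have [->|ty] := eqVneq t y; first exact: Or32.
apply: Or33; have := cubic_roots_sum xy yz xz hx hy hz.
by rewrite -(cubic_roots_sum tx xy ty ht hx hy) -[RHS]addrA [RHS]addrC => /addrI.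
Qed.

(** For [k <= l] the outer roots lie strictly between consecutive integers. If the middle root [r]
    is an integer, [k + l + 4 - r] lies strictly between [l + 2] and [l + 4], so [r = k + 1], where
    the cubic takes the value [k * (l - k)]. *)
Lemma int_root_cubic (R : realType) (k l : nat) (r : int) :
  (0 < k)%N -> (0 < l)%N -> cubic k.+1%:R l.+1%:R r = 0 -> k = l.
Proof.
wlog kl : k l / (k <= l)%N => [H k0 l0 hr|k0 l0 hr].
  have [kl|/ltnW lk] := leqP k l; first exact: (H k l).
  by apply/esym; apply: (H l k) => //; rewrite cubicC.
have hrR : cubic k.+1%:R l.+1%:R r%:~R = 0 :> R.
  by have := congr1 (intr : int -> R) hr; rewrite rmorph_cubic !rmorph_nat.
have [||l1 [l2 [l3 [h1 h2 h3 [r1 r2 r3]]]]] := @cubic_roots_le R k.+1%:R l.+1%:R.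
- by rewrite ler_nat.
- by rewrite ler_nat ltnS.
have n12 : l1 != l2 by apply/eqP; lra.
have n23 : l2 != l3 by apply/eqP; lra.
have n13 : l1 != l3 by apply/eqP; lra.
have hs := cubic_roots_sum n12 n23 n13 r1 r2 r3.
have natE n : n%:R = n%:Z%:~R :> R by [].
case: (cubic_root_cases n12 n23 n13 r1 r2 r3 hrR) => rE.
- move: h1; rewrite -rE ltr0z ltrz1; lia.
- have rE' : r = k.+1.
    have : (l%:Z + 2)%:~R < (k%:Z + l%:Z + 4 - r)%:~R :> R.
      rewrite !rmorphD/= rmorphN/= rE -!natE; move: hs; rewrite -!natr1; lra.
    have : (k%:Z + l%:Z + 4 - r)%:~R < (l%:Z + 4)%:~R :> R.
      rewrite !rmorphD/= rmorphN/= rE -!natE; move: hs; rewrite -!natr1; lra.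
    rewrite !ltr_int; lia.
  move: hr; rewrite rE' /cubic; nia.
- have : (l%:Z + 2)%:~R < r%:~R :> R.
    by rewrite rmorphD/= -natE; move: h3; rewrite rE -natr1; lra.
  have : r%:~R < (l%:Z + 3)%:~R :> R.
    by rewrite rmorphD/= -natE; move: h3; rewrite rE -natr1; lra.
  rewrite !ltr_int; lia.
Qed.

(** * Irreducibility of p and rational independence of its roots *)

Lemma horner_dstar_p (k l : nat) (x : rat) :
  (dstar_p k l).[x] = cubic k.+1%:R l.+1%:R x.
Proof. by rewrite /dstar_p /cubic !hornerE. Qed.

Lemma size_dstar_p (k l : nat) : size (dstar_p k l) = 4.
Proof.
have sz (a b : rat) : size (('X - a%:P) * ('X - b%:P)) = 3%N.
  by rewrite size_monicM ?monicXsubC ?size_XsubC ?monic_neq0 ?monicXsubC.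
have szX (a b : rat) : size ('X * ('X - a%:P) * ('X - b%:P)) = 4%N.
  by rewrite -mulrA mulrC size_mulX ?sz// -size_poly_gt0 sz.
rewrite /dstar_p -addrA size_polyDl szX// ltnS (leq_trans (size_polyD _ _))//.
by rewrite !size_polyN geq_max -polyC1 !sz.
Qed.

(** Clearing denominators shows that the denominator divides the cube of the numerator, to which it
    is coprime. *)
Lemma rat_root_int (k l : nat) (x : rat) :
  cubic k.+1%:R l.+1%:R x = 0 -> exists r : int, x = r%:~R.
Proof.
move=> hx; exists (numq x).
pose n := numq x; pose d := denq x; pose a : int := k.+1; pose b : int := l.+1.
have d0 : d%:~R != 0 :> rat by rewrite intr_eq0 denq_eq0.
have xnd : x = n%:~R / d%:~R by rewrite divq_num_den.
have E : n * (n - a * d) * (n - b * d) = d * ((n - d) * (n - a * d) + (n - d) * (n - b * d)).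
  apply: (@intr_inj rat); rewrite !(rmorphM, rmorphB, rmorphD)/=.
  apply/eqP; rewrite -subr_eq0; apply/eqP.
  transitivity (d%:~R ^+ 3 * cubic k.+1%:R l.+1%:R x : rat); last by rewrite hx mulr0.
  by rewrite /cubic xnd /a /b; field.
have dn : (d %| n ^+ 3)%Z.
  apply/dvdzP; exists ((n - d) * (n - a * d) + (n - d) * (n - b * d)
    + (a + b) * n ^+ 2 - a * b * n * d).
  apply/eqP; rewrite -subr_eq0; apply/eqP.
  transitivity (n * (n - a * d) * (n - b * d)
    - d * ((n - d) * (n - a * d) + (n - d) * (n - b * d))); last by rewrite E subrr.
  ring.
have d1 : d = 1.
  have : coprimez d (n ^+ 3).
    by apply: coprimezXr; rewrite coprimez_sym; exact: coprime_num_den.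
  rewrite /coprimez => /eqP g1.
  have : (d %| gcdz d (n ^+ 3))%Z by rewrite dvdz_gcd dvdzz.
  by rewrite g1 dvdz1 => /eqP d1; have := gtz0_abs (denq_gt0 x); rewrite -/d d1 => <-.
by rewrite [LHS]xnd d1 divr1.
Qed.

(** A reducible cubic has a rational root, here an integer, which forces [k = l]; conversely [k + 1]
    is then a root. The field [R] enters through the location of the roots. *)
Lemma dstar_p_irreducible (R : realType) (k l : nat) : (0 < k)%N -> (0 < l)%N ->
  irreducible_poly (dstar_p k l) <-> k != l.
Proof.
move=> k0 l0; split=> [irr|kl].
  apply/eqP => kl; case: irr; rewrite size_dstar_p => _ /(_ ('X - k.+1%:R%:P)).
  rewrite size_XsubC dvdp_XsubCl /root horner_dstar_p => /(_ isT).
  have -> : cubic k.+1%:R l.+1%:R k.+1%:R = 0 :> rat by rewrite /cubic kl; ring.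
  by move=> /(_ (eqxx _))/eqp_size; rewrite size_XsubC size_dstar_p.
apply: cubic_irreducible => [|x]; first by rewrite size_dstar_p.
apply/negP => /rootP; rewrite horner_dstar_p => hx.
have [r xr] := rat_root_int hx; move: hx; rewrite xr => hx.
move/eqP: kl; apply; apply: (int_root_cubic R (r := r)) => //.
apply: (@intr_inj rat); rewrite rmorph_cubic -[RHS]hx.
by rewrite !rmorph_nat.
Qed.

(** An irreducible cubic is coprime to every nonzero polynomial of degree at most 2, so they share
    no root in [R]. *)
Lemma cubic_root_quadratic (R : realType) (k l : nat) (A B C : rat) (x : R) :
  irreducible_poly (dstar_p k l) -> cubic k.+1%:R l.+1%:R x = 0 ->
  ratr A * x ^+ 2 + ratr B * x + ratr C = 0 -> [/\ A = 0, B = 0 & C = 0].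
Proof.
move=> irr hx hq; pose q := Poly [:: C; B; A].
have [q0|q0] := eqVneq q 0.
  have coef i : [:: C; B; A]`_i = 0 by rewrite -coef_Poly -/q q0 coef0.
  by split; [exact: (coef 2%N)|exact: (coef 1%N)|exact: (coef 0%N)].
have : coprimep (dstar_p k l) q.
  rewrite irreducible_poly_coprime//; apply/negP => /(dvdp_leq q0).
  by rewrite size_dstar_p leqNgt ltnS (size_Poly [:: C; B; A]).
rewrite -(coprimep_map (ratr : {rmorphism rat -> R})) => /coprimep_root.
move=> /(_ x); rewrite /root.
have -> : (map_poly ratr (dstar_p k l)).[x] = 0.
  rewrite /dstar_p !(rmorphB, rmorphM)/= rmorph1 !map_polyX !map_polyC/= !ratr_nat.
  by rewrite -hx /cubic !hornerE.
move=> /(_ (eqxx _)) /negP[].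
rewrite /q /= !cons_poly_def !(rmorphM, rmorphD)/= rmorph0 map_polyX !map_polyC/=.
by rewrite !hornerE -hq; apply/eqP; ring.
Qed.

(* A relation would make [y] an affine image [q0 + q1 x] of [x]; by irreducibility
   the affine map permutes the roots, so it fixes their mean and has slope 1. *)
Lemma cubic_roots_indep (R : realType) (k l : nat) (x y : R) (m0 m1 m2 : int) :
  (0 < k)%N -> (0 < l)%N -> k != l -> x != y ->
  cubic k.+1%:R l.+1%:R x = 0 -> cubic k.+1%:R l.+1%:R y = 0 ->
  m0%:~R + m1%:~R * x + m2%:~R * y = 0 -> [/\ m0 = 0, m1 = 0 & m2 = 0].
Proof.
move=> k0 l0 kl xy hx hy hm.
have irr : irreducible_poly (dstar_p k l) by apply/(dstar_p_irreducible R).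
have noroot (z : rat) : cubic k.+1%:R l.+1%:R z != 0.
  apply/negP => /eqP hz; have [r zr] := rat_root_int hz.
  move/eqP: kl; apply; apply: (int_root_cubic R (r := r)) => //.
  apply: (@intr_inj rat); rewrite rmorph_cubic -[RHS]hz zr.
  by rewrite !rmorph_nat.
have [m20|m20] := eqVneq m2 0.
  have [] := @cubic_root_quadratic R k l 0 m1%:~R m0%:~R x irr hx.
    by rewrite !ratr_int rmorph0 mul0r add0r -hm m20 mul0r addr0 addrC.
  by move=> _ /eqP; rewrite intr_eq0 => /eqP -> /eqP; rewrite intr_eq0 => /eqP ->.
exfalso; have m2R : m2%:~R != 0 :> R by rewrite intr_eq0.
have [q0 [q1 yE]] : exists q0 q1 : rat, y = ratr q0 + ratr q1 * x.
  exists (- m0%:~R / m2%:~R), (- m1%:~R / m2%:~R).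
  rewrite !fmorph_div/= !rmorphN/= !ratr_int.
  apply: (mulfI m2R); apply/eqP; rewrite -subr_eq0 -hm; apply/eqP; field.
  exact: m2R.
(* [s], [e] and [p] are the elementary symmetric functions of the roots. *)
pose s : rat := k.+1%:R + l.+1%:R + 2.
pose e : rat := k.+1%:R * l.+1%:R + k.+1%:R + l.+1%:R + 2.
pose p : rat := k.+1%:R + l.+1%:R.
have cE (z : rat) : cubic k.+1%:R l.+1%:R z = z ^+ 3 - s * z ^+ 2 + e * z - p.
  by rewrite /cubic /s /e /p; ring.
(* These are the coefficients of p(q0 + q1 X) - q1^3 p(X), which has degree at most 2 and vanishes
   at [x]. *)
have [] := @cubic_root_quadratic R k l (3 * q0 * q1 ^+ 2 - s * q1 ^+ 2 + q1 ^+ 3 * s)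
  (3 * q0 ^+ 2 * q1 - 2 * s * q0 * q1 + e * q1 - q1 ^+ 3 * e)
  (q0 ^+ 3 - s * q0 ^+ 2 + e * q0 - p + q1 ^+ 3 * p) x irr hx.
  transitivity (cubic k.+1%:R l.+1%:R y - ratr q1 ^+ 3 * cubic k.+1%:R l.+1%:R x).
    rewrite yE /cubic /s /e /p !(rmorphD, rmorphB, rmorphM, rmorphXn)/= !ratr_nat; ring.
  by rewrite hx hy mulr0 subr0.
move=> A0 B0 C0.
have q1N0 : q1 != 0.
  apply: contraNneq (noroot q0) => q10; rewrite cE -C0 q10; apply/eqP; ring.
have q0E : q0 = s * (1 - q1) / 3.
  apply: (mulfI (expf_neq0 2 q1N0)); apply/eqP; rewrite -subr_eq0; apply/eqP.
  transitivity ((3 * q0 * q1 ^+ 2 - s * q1 ^+ 2 + q1 ^+ 3 * s) / 3); first by field.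
  by rewrite A0 mul0r.
(* The mean [s / 3] is a fixed point of the affine map; evaluating there leaves (1 - q1^3) p(s/3) =
   0, and p has no rational root. *)
have q11 : q1 = 1.
  have : (1 - q1 ^+ 3) * cubic k.+1%:R l.+1%:R (s / 3) = 0.
    rewrite cE; transitivity ((s / 3) ^+ 2 * (3 * q0 * q1 ^+ 2 - s * q1 ^+ 2 + q1 ^+ 3 * s)
      + s / 3 * (3 * q0 ^+ 2 * q1 - 2 * s * q0 * q1 + e * q1 - q1 ^+ 3 * e)
      + (q0 ^+ 3 - s * q0 ^+ 2 + e * q0 - p + q1 ^+ 3 * p)).
      by rewrite q0E; field.
    by rewrite A0 B0 C0 !mulr0 !addr0.
  move/eqP; rewrite mulf_eq0 (negbTE (noroot _)) orbF.
  have -> : 1 - q1 ^+ 3 = (1 - q1) * (q1 ^+ 2 + q1 + 1) by ring.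
  rewrite mulf_eq0 subr_eq0 => /orP[/eqP //|/eqP]; nra.
move/eqP: xy; apply.
by rewrite yE q0E q11 subrr mulr0 mul0r rmorph0 rmorph1 add0r mul1r.
Qed.

(** * Simultaneous inhomogeneous approximation *)

(** Pigeonhole: [M * M + 1] multiples of the pair fall, modulo 1, into [M * M] boxes of side
    [1 / M]. *)
Lemma dirichlet2 (R : realType) (x y e : R) : 0 < e ->
  exists (n : nat) (p q : int), [/\ (0 < n)%N, `|n%:R * x - p%:~R| < e & `|n%:R * y - q%:~R| < e].
Proof.
move=> e0; pose M := (Num.bound e^-1).+1.
have M0 : 0 < M%:R :> R by rewrite ltr0n.
have Me : M%:R^-1 < e.
  rewrite invf_plt ?posrE// (lt_trans (archi_boundP _))// ?invr_ge0 ?ltW//.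
  by rewrite ltr_nat.
pose fr (z : R) := z - (Num.floor z)%:~R.
have fr_ge0 z : 0 <= fr z by rewrite subr_ge0; case/andP: (Num.Theory.floor_itv z).
have fr_lt1 z : fr z < 1 by rewrite ltrBlDl; have := Num.Theory.floorD1_gt z; rewrite rmorphD/= addrC.
pose b z := Num.truncn (M%:R * fr z).
have bP z : (b z)%:R <= M%:R * fr z < (b z).+1%:R.
  by apply: Num.Theory.truncn_itv; rewrite mulr_ge0// ltW.
have bM z : (b z < M)%N.
  have /andP[h _] := bP z; rewrite -(ltr_nat R) (le_lt_trans h)//.
  by rewrite gtr_pMr.
have close z z' : b z = b z' -> `|fr z - fr z'| < e.
  move=> bzz'; apply: lt_trans Me; rewrite -(ltr_pM2l M0) divff ?gt_eqF//.
  rewrite -[X in X * _]ger0_norm ?ltW// -normrM ltr_norml mulrBr.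
  have := bP z; have := bP z'; rewrite bzz' -natr1 => /andP[? ?] /andP[? ?].
  by apply/andP; split; lra.
pose F (i : 'I_(M * M).+1) : 'I_M * 'I_M :=
  (Ordinal (bM (i%:R * x)), Ordinal (bM (i%:R * y))).
have /injectivePn[i [j ij Fij]] : ~~ injectiveb F.
  apply/injectiveP => /leq_card; rewrite card_prod !card_ord.
  by rewrite ltnn.
wlog lij : i j ij Fij / (i < j)%N.
  move=> H; have : i != j :> nat by [].
  by rewrite neq_ltn => /orP[|] lij; [exact: (H i j)|apply: (H j i); rewrite // eq_sym].
move: Fij => [hx hy].
have ijE (z : R) : fr (j%:R * z) - fr (i%:R * z) = (j - i)%:R * z
    - (Num.floor (j%:R * z) - Num.floor (i%:R * z))%:~R.
  by rewrite /fr natrB ?(ltnW lij)// rmorphB/=; ring.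
exists (j - i)%N, (Num.floor (j%:R * x) - Num.floor (i%:R * x)),
  (Num.floor (j%:R * y) - Num.floor (i%:R * y)).
by rewrite -!ijE subn_gt0; split=> //; apply: close.
Qed.

(* Lettenmeyer's argument: two returns close to the origin, the second one so close
   that it cannot be parallel to the first, span a lattice with small cells. *)
Lemma kronecker2 (R : realType) (x y s t e : R) :
  (forall m0 m1 m2 : int, m0%:~R + m1%:~R * x + m2%:~R * y = 0 ->
     [/\ m0 = 0, m1 = 0 & m2 = 0]) ->
  0 < e ->
  exists n p q : int,
    `|n%:~R * x - p%:~R - s| < e /\ `|n%:~R * y - q%:~R - t| < e.
Proof.
move=> indep e0; have e2 : 0 < e / 2 by rewrite divr_gt0.
have [n [p [q [n0 hp hq]]]] := dirichlet2 x y e2.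
set u1 := _ - p%:~R in hp; set u2 := _ - q%:~R in hq.
have nR0 : 0 < n%:R :> R by rewrite ltr0n.
have u10 : u1 != 0.
  apply: contraTneq n0 => u10; rewrite -leqNgt leqn0.
  have [|_ /eqP] := indep (- p) n 0; last by [].
  by rewrite mul0r addr0 rmorphN/= addrC.
have e3 : 0 < Num.min (e / 2) (`|u1| / n%:R).
  by rewrite lt_min e2 divr_gt0// normr_gt0.
have [n' [p' [q' []]]] := dirichlet2 x y e3.
set v1 := _ - p'%:~R; set v2 := _ - q'%:~R.
rewrite !lt_min => n'0 /andP[hv1 hv1'] /andP[hv2 _].
(* A zero determinant is an integer relation between 1, [x] and [y]. Its vanishing coefficients give
   [n' u1 = n v1], against the bound [|u1| / n] on [v1]. *)
have D0 : u1 * v2 - u2 * v1 != 0.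
  apply/eqP => D0.
  have [|_ _ h] := indep (p * q' - q * p') (q * n'%:Z - n%:Z * q') (n%:Z * p' - p * n'%:Z).
    rewrite -[RHS]D0 /u1 /u2 /v1 /v2 !(rmorphB, rmorphM)/= -!pmulrn; ring.
  have hR : n'%:R * u1 = n%:R * v1.
    have h' : n%:R * p'%:~R - p%:~R * n'%:R = 0 :> R.
      by have := congr1 (intr : int -> R) h; rewrite rmorphB !rmorphM/= -!pmulrn.
    by apply/eqP; rewrite -subr_eq0 -h' /u1 /v1; apply/eqP; ring.
  have : `|u1| <= `|n'%:R * u1| by rewrite normrM normr_nat ler_peMl// ler1n.
  by rewrite hR normrM normr_nat leNgt -ltr_pdivlMl// mulrC hv1'.
(* Cramer's rule gives the coordinates of the target in the basis of the two returns; rounding them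
   down moves the point by at most the sum of the two vectors. *)
pose al := (s * v2 - t * v1) / (u1 * v2 - u2 * v1).
pose be := (u1 * t - u2 * s) / (u1 * v2 - u2 * v1).
have sE : s = al * u1 + be * v1 by rewrite /al /be; field.
have tE : t = al * u2 + be * v2 by rewrite /al /be; field.
pose A := Num.floor al; pose B := Num.floor be.
have small (w w' : R) : `|w| < e / 2 -> `|w'| < e / 2 ->
    `|A%:~R * w + B%:~R * w' - (al * w + be * w')| < e.
  move=> hw hw'; rewrite (_ : _ - _ = (A%:~R - al) * w + (B%:~R - be) * w'); last by ring.
  have fl (z c : R) : `|c| < e / 2 -> `|((Num.floor z)%:~R - z) * c| < e / 2.
    move=> hc; apply: le_lt_trans hc; rewrite normrM ler_piMl// distrC ler_norml.
    have /andP[] := Num.Theory.floor_itv z; rewrite rmorphD/= => *.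
    by apply/andP; split; lra.
  by rewrite [e]splitr (le_lt_trans (ler_normD _ _))// ltrD// fl.
exists (A * n + B * n'), (A * p + B * p'), (A * q + B * q'); split.
- apply: le_lt_trans (small _ _ hp hv1); rewrite -sE !(rmorphD, rmorphM)/= /u1 /v1 -!pmulrn.
  by rewrite le_eqVlt; apply/orP; left; apply/eqP; congr `|_|; ring.
- apply: le_lt_trans (small _ _ hq hv2); rewrite -tE !(rmorphD, rmorphM)/= /u2 /v2 -!pmulrn.
  by rewrite le_eqVlt; apply/orP; left; apply/eqP; congr `|_|; ring.
Qed.

(** * Limits of phases and sufficient conditions for transfer *)

Lemma cosD2piz (R : realType) (x : R) (z : int) : cos (x + 2 * pi * z%:~R) = cos x.
Proof.
have nat_case n y : cos (y + 2 * pi * n%:R) = cos y :> R.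
  elim: n => [|n IH]; first by rewrite mulr0 addr0.
  rewrite -[RHS]IH -[RHS]cosD2pi -natr1; congr cos; rewrite -mulr_natl; ring.
case: z => n; first exact: nat_case.
by rewrite NegzE -[LHS](nat_case n.+1) rmorphN/= -pmulrn; congr cos; ring.
Qed.

Lemma sinD2piz (R : realType) (x : R) (z : int) : sin (x + 2 * pi * z%:~R) = sin x.
Proof.
have sinE (y : R) : sin y = cos (y - pi / 2) by rewrite cosBpihalf.
by rewrite !sinE addrAC cosD2piz.
Qed.

(** Convergence of exp(i u) to a real number [c]. *)
Definition cis_cvg (R : realType) (u : nat -> R) (c : R) :=
  (fun n => cos (u n)) @ \oo --> c /\ (fun n => sin (u n)) @ \oo --> (0 : R).

Lemma cis_cvgD (R : realType) (u v : nat -> R) (c d : R) :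
  cis_cvg u c -> cis_cvg v d -> cis_cvg (fun n => u n + v n) (c * d).
Proof.
move=> [uc us] [vc vs]; split.
- have -> : c * d = c * d - 0 * 0 by rewrite mulr0 subr0.
  by under eq_fun do rewrite cosD; apply: cvgB; exact: cvgM.
- have -> : 0 = 0 * d + c * 0 :> R by rewrite mulr0 mul0r addr0.
  by under eq_fun do rewrite sinD; apply: cvgD; exact: cvgM.
Qed.

Lemma cis_cvgM (R : realType) (u : nat -> R) (c : R) (m : nat) :
  cis_cvg u c -> cis_cvg (fun n => u n * m%:R) (c ^+ m).
Proof.
move=> uc; elim: m => [|m IH].
  by split; under eq_fun do rewrite mulr0 ?cos0 ?sin0; exact: cvg_cst.
have E n : u n * m.+1%:R = u n * m%:R + u n by rewrite -natr1 mulrDr mulr1.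
rewrite exprSr; have [h1 h2] := cis_cvgD IH uc.
by split; under eq_fun do rewrite E.
Qed.

Lemma cis_cvg_unique (R : realType) (u : nat -> R) (c d : R) :
  cis_cvg u c -> cis_cvg u d -> c = d.
Proof. by move=> [h _] [h' _]; exact: (cvg_unique (@norm_hausdorff _ R) h h'). Qed.

Lemma cis_cvg_near2pi (R : realType) (u : nat -> R) (z : nat -> int) (c : R) :
  (forall n, `|u n - (c + 2 * pi * (z n)%:~R)| < harmonic n) ->
  (fun n => cos (u n)) @ \oo --> cos c /\ (fun n => sin (u n)) @ \oo --> sin c.
Proof.
move=> h; pose v n := u n - 2 * pi * (z n)%:~R.
have uE n : u n = v n + 2 * pi * (z n)%:~R by rewrite /v subrK.
have vc : v @ \oo --> c.
  apply/cvgrPdist_lt => e e0; have /cvgrPdist_lt/(_ e e0) := @cvg_harmonic R.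
  apply: filterS => n; rewrite sub0r normrN ger0_norm ?harmonic_ge0//.
  apply: lt_trans; rewrite distrC (le_lt_trans _ (h n))// le_eqVlt; apply/orP; left.
  by apply/eqP; congr `|_|; rewrite /v; ring.
split.
- under eq_fun do rewrite uE cosD2piz.
  by apply: continuous_cvg vc; exact: continuous_cos.
- under eq_fun do rewrite uE sinD2piz.
  by apply: continuous_cvg vc; exact: continuous_sin.
Qed.

(** Four distinct eigenvalues span all functions constant on the cells, so they suffice when the
    indicator of [v] is such a function. The phase at the degree is required to be exact, those at
    the eigenvalues only approximate. *)
Lemma blowup2_dstar_LPGST (R : realType) (k l : nat) (lam : 'I_4 -> R) (d : R)
    (x y u w : R) (v : 'I_(k + l + 2)) :
  (0 < l)%N -> injective lam ->
  (forall j, lam j * cubic k.+1%:R l.+1%:R (lam j) = 0) ->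
  (forall i : 'I_(k + l + 2), dstar_fun k x y u w i = (i == v)%:R) ->
  \sum_i (dstar_adj v i)%:R = d ->
  (forall e : R, 0 < e -> exists (t : R) (z : 'I_4 -> int) (m : int),
    (forall j, `|t * lam j - 2 * pi * (z j)%:~R| < e) /\ t * d = pi + 2 * pi * m%:~R) ->
  LPGST R (blowup2 (@dstar_adj k l)) (ord0, v) (ord_max, v).
Proof.
move=> l0 lamI hlam hv hd approx.
have [t /choice[z /choice[m H]]] := choice (fun n => approx _ (@harmonic_gt0 R n)).
have [c Hc] := dstar_eigen_span k x y u w l0 lamI.
have Hl j : (fun n => cos (t n * lam j)) @ \oo --> (1 : R) /\
    (fun n => sin (t n * lam j)) @ \oo --> (0 : R).
  have := @cis_cvg_near2pi R (fun n => t n * lam j) (fun n => z n j) 0.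
  rewrite cos0 sin0; apply => n.
  by rewrite add0r; exact: (H n).1.
have [Hd1 Hd2] : (fun n => cos (t n * d)) @ \oo --> (-1 : R) /\
    (fun n => sin (t n * d)) @ \oo --> (0 : R).
  have := @cis_cvg_near2pi R (fun n => t n * d) m pi.
  rewrite cospi sinpi; apply => n.
  by rewrite (H n).2 subrr normr0 harmonic_gt0.
apply: (blowup2_LPGST (f := fun j (i : 'I_(k + l + 2)) => c j * dstar_eigen k l (lam j) i) (t := t)
  (mu := lam) hd) => // [j|i|j|j].
- exact: eigenfun_dstar_eigen.
- by rewrite Hc hv.
- exact: (Hl j).1.
- exact: (Hl j).2.
Qed.

(** With [A = 2 ^ al], times that are odd multiples of [pi / A] give phase -1 at [A * d] exactly.
    The roots sum to an even multiple of [A], so phases near 1 at two roots force it at the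
    third. *)
Lemma kronecker_dstar (R : realType) (k l c d al : nat) (x y z : R) :
  (0 < k)%N -> (0 < l)%N -> k != l ->
  x != y -> y != z -> x != z ->
  cubic k.+1%:R l.+1%:R x = 0 -> cubic k.+1%:R l.+1%:R y = 0 ->
  cubic k.+1%:R l.+1%:R z = 0 ->
  (k + l + 4 = 2 ^ al * c.*2)%N -> odd d ->
  forall e : R, 0 < e -> exists (t : R) (p q r m : int),
    [/\ `|t * x - 2 * pi * p%:~R| < e, `|t * y - 2 * pi * q%:~R| < e,
        `|t * z - 2 * pi * r%:~R| < e & t * (2 ^ al * d)%N%:R = pi + 2 * pi * m%:~R].
Proof.
move=> k0 l0 kl xy yz xz hx hy hz hs od e e0.
have A0 : (2 ^ al)%N%:R != 0 :> R by rewrite pnatr_eq0 expn_eq0.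
set A := (2 ^ al)%N%:R in A0 *.
have pi0 := @pi_gt0 R.
have e4 : 0 < e / (4 * pi) by rewrite divr_gt0// mulr_gt0.
have indep (m0 m1 m2 : int) : m0%:~R + m1%:~R * (x / A) + m2%:~R * (y / A) = 0 ->
    [/\ m0 = 0, m1 = 0 & m2 = 0].
  move=> /(congr1 (fun u => u * A)); rewrite mul0r !mulrDl -!mulrA !mulVf// !mulr1 => h.
  have [|h0 -> ->] := @cubic_roots_indep R k l x y (m0 * (2 ^ al)%N%:Z) m1 m2
    k0 l0 kl xy hx hy.
    by rewrite rmorphM/= -[(2 ^ al)%N%:~R]pmulrn.
  split=> //; move/eqP: h0; rewrite mulf_eq0 => /orP[/eqP //|].
  by rewrite eqz_nat expn_eq0.
(* The targets compensate the half in [n + 1/2]. The tolerance becomes [e / 2] after scaling by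
   [2 pi], leaving room for two errors to add up at [z]. *)
have [n [p [q [hp hq]]]] := kronecker2 (- (x / A / 2)) (- (y / A / 2)) indep e4.
pose t := 2 * pi * (n%:~R + 2^-1) / A.
have near w (r : int) : `|n%:~R * (w / A) - r%:~R - - (w / A / 2)| < e / (4 * pi) ->
    `|t * w - 2 * pi * r%:~R| < e / 2.
  rewrite ltr_pdivlMr ?mulr_gt0// => h.
  rewrite (_ : t * w - _ = 2 * pi * (n%:~R * (w / A) - r%:~R - - (w / A / 2))); last first.
    by rewrite /t; field.
  rewrite normrM gtr0_norm ?mulr_gt0//; lra.
have {}hp := near _ _ hp; have {}hq := near _ _ hq.
have lt_e w : w < e / 2 -> w < e by lra.
have hsum : x + y + z = A * (c%:R * 2).
  rewrite (cubic_roots_sum xy yz xz hx hy hz) /A -natrM muln2 -natrM -hs.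
  by rewrite !natrD -!natr1; ring.
have [h dE] : exists h, d = h.*2.+1.
  by exists d./2; rewrite -[LHS]odd_double_half od.
exists t, p, q, ((2 * n + 1) * c%:Z - p - q), (2 * n * h%:Z + n + h%:Z); split.
- exact: lt_e.
- exact: lt_e.
- rewrite (_ : t * z - _ = - ((t * x - 2 * pi * p%:~R) + (t * y - 2 * pi * q%:~R))).
    by rewrite normrN (le_lt_trans (ler_normD _ _))// [e]splitr ltrD.
  have -> : z = A * (c%:R * 2) - x - y by rewrite -hsum; ring.
  rewrite /t !(rmorphB, rmorphM, rmorphD)/= -!pmulrn; field.
  exact: A0.
- rewrite natrM -/A dE -natr1 -muln2 natrM /t !(rmorphM, rmorphD)/= -!pmulrn; field.
  exact: A0.
Qed.

(** Each step multiplies y + x sqrt 2 by the fundamental unit 3 + 2 sqrt 2. *)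
Lemma pell2 (N : nat) : exists x y : nat, [/\ (N <= x)%N, odd y & (y ^ 2 = 2 * x ^ 2 + 1)%N].
Proof.
elim: N => [|N [x [y [Nx oy xy]]]]; first by exists 0%N, 1%N.
exists (2 * y + 3 * x)%N, (3 * y + 4 * x)%N; split; last by nia.
- have : (0 < y)%N by case: (y) oy.
  by lia.
- by rewrite oddD !oddM oy.
Qed.

Lemma pell_approx (R : realType) (s e : R) : 0 < s -> s ^+ 2 = 2 -> 0 < e ->
  exists x y : nat, odd y /\ `|y%:R * s - x.*2%:R| < e.
Proof.
move=> s0 s2 e0.
have [x [y [Nx oy xy]]] := pell2 (Num.bound e^-1).+1.
have x0 : 0 < x%:R :> R by rewrite ltr0n; case: (x) Nx.
have ex : x%:R^-1 < e.
  rewrite invf_plt ?posrE// (lt_le_trans (archi_boundP _))// ?invr_ge0 ?ltW//.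
  by rewrite ltr_nat.
exists x, y; split=> //; apply: le_lt_trans ex.
have y0 : 0 < y%:R :> R by rewrite ltr0n; case: (y) oy.
have xyR : y%:R ^+ 2 = 2 * x%:R ^+ 2 + 1 :> R.
  by have := congr1 (fun n => n%:R : R) xy; rewrite natrD natrM !natrX.
have P : 0 < y%:R * s + 2 * x%:R by rewrite addr_gt0 ?mulr_gt0.
(* Rationalising: by Pell's equation the difference of the squares is 2. *)
have E : y%:R * s - x.*2%:R = 2 / (y%:R * s + 2 * x%:R).
  apply: (mulIf (lt0r_neq0 P)); rewrite divfK ?lt0r_neq0// -muln2 natrM.
  transitivity (y%:R ^+ 2 * s ^+ 2 - 4 * x%:R ^+ 2); first by ring.
  by rewrite s2 xyR; ring.
have P_ge0 := ltW P.
rewrite E ger0_norm ?divr_ge0// ler_pdivrMr// mulrDr.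
have -> : x%:R^-1 * (2 * x%:R) = 2 :> R by field; rewrite gt_eqF.
by rewrite lerDr !mulr_ge0// ?invr_ge0 ltW.
Qed.

(** * State transfer on the double star *)

(** With different valuations, that of [a + b] is at most that of [a], so some odd multiple of [a]
    is a multiple of [a + b]. Phases tending to 1 at [a + b] and to -1 at [a] are then
    incompatible. *)
Lemma nu2_add_dvd (a b : nat) : (0 < a)%N -> (0 < b)%N -> nu2 a != nu2 b ->
  exists m m' : nat, ((a + b) * m = a * m')%N /\ odd m'.
Proof.
move=> a0 b0 hab; have s0 : (0 < a + b)%N by rewrite addn_gt0 a0.
have le_s : (nu2 (a + b) <= nu2 a)%N.
  rewrite leqNgt; apply/negP => lt_s; move: hab; rewrite neq_ltn /nu2 => /orP[] h.
  - have : (2 ^ (logn 2 a).+1 %| a + b)%N by rewrite pfactor_dvdn.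
    by rewrite dvdn_addl ?pfactor_dvdn// ltnn.
  - have : (2 ^ (logn 2 b).+1 %| a + b)%N by rewrite pfactor_dvdn// (ltn_trans h).
    by rewrite dvdn_addr ?pfactor_dvdn// ltnn.
have [a' oa aE] := @pfactor_coprime 2 _ isT a0.
have [s' os sE] := @pfactor_coprime 2 _ isT s0.
exists (a' * 2 ^ (nu2 a - nu2 (a + b)))%N, s'; split; last by rewrite -coprime2n.
have powE : (2 ^ nu2 a = 2 ^ (nu2 a - nu2 (a + b)) * 2 ^ nu2 (a + b))%N.
  by rewrite -expnD subnK.
transitivity (s' * 2 ^ nu2 (a + b) * (a' * 2 ^ (nu2 a - nu2 (a + b))))%N.
  by congr (_ * _)%N.
transitivity (a' * 2 ^ nu2 a * s')%N; last by congr (_ * _)%N.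
by rewrite powE mulnC mulnACA [RHS]mulnAC mulnA -!mulnA.
Qed.

(** With a common valuation [al], the odd parts of [a] and [b] add up to an even number. *)
Lemma nu2_add_eq (a b : nat) : (0 < a)%N -> (0 < b)%N -> nu2 a = nu2 b ->
  exists al c d : nat, [/\ (a + b = 2 ^ al * c.*2)%N, a = (2 ^ al * d)%N & odd d].
Proof.
move=> a0 b0 hab.
have [a' oa aE] := @pfactor_coprime 2 _ isT a0.
have [b' ob bE] := @pfactor_coprime 2 _ isT b0.
rewrite !coprime2n in oa ob.
exists (nu2 a), ((a' + b')./2), a'; split=> //; last by rewrite mulnC.
rewrite -[RHS]addn0 {1}aE {1}bE -/(nu2 a) -/(nu2 b) -hab -mulnDl mulnC addn0; congr (_ * _)%N.
by rewrite -[LHS]odd_double_half oddD oa ob.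
Qed.

Lemma dstar_roots (R : realType) (k l : nat) : (0 < k)%N -> (0 < l)%N ->
  exists x y z : R,
    [/\ x < y < z, 0 < x & [/\ cubic k.+1%:R l.+1%:R x = 0,
      cubic k.+1%:R l.+1%:R y = 0 & cubic k.+1%:R l.+1%:R z = 0]].
Proof.
wlog kl : k l / (k <= l)%N => [H k0 l0|k0 l0].
  have [kl|/ltnW lk] := leqP k l; first exact: H.
  have [x [y [z [xyz x0 [hx hy hz]]]]] := H _ _ lk l0 k0.
  by exists x, y, z; split=> //; split; rewrite cubicC.
have [||x [y [z [hx hy hz r]]]] := @cubic_roots_le R k.+1%:R l.+1%:R.
- by rewrite ler_nat.
- by rewrite ler_nat ltnS.
by exists x, y, z; split; [lra|lra|].
Qed.

(** All three roots are in the support of [v]; multiplying their phases gives the limit at their sum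
    [k + l + 4]. *)
Lemma LPGST_blowup2_dstar (R : realType) (k l : nat) (v : 'I_(k + l + 2)) (d : R) :
  (0 < k)%N -> (0 < l)%N -> \sum_w (dstar_adj v w)%:R = d ->
  (forall x : R, x * cubic k.+1%:R l.+1%:R x = 0 -> dstar_eigen k l x v != 0) ->
  LPGST R (blowup2 (@dstar_adj k l)) (ord0, v) (ord_max, v) ->
  exists t : nat -> R, [/\ cis_cvg (fun n => t n * d) (-1),
    cis_cvg (fun n => t n * (k + l + 4)%:R) 1,
    forall x : R, cubic k.+1%:R l.+1%:R x = 0 -> cis_cvg (fun n => t n * x) 1 &
    forall mu (f : 'I_(k + l + 2) -> R), eigenfun (@dstar_adj k l) mu f -> f v != 0 ->
      cis_cvg (fun n => t n * mu) 1].
Proof.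
move=> k0 l0 hd hv /(LPGST_blowup2 (@dstar_adjC k l) hd)[t [Hf Hd]].
have Hr x : cubic k.+1%:R l.+1%:R x = 0 -> cis_cvg (fun n => t n * x) 1.
  move=> hx; have hx' : x * cubic k.+1%:R l.+1%:R x = 0 by rewrite hx mulr0.
  have := Hf x _ (eigenfun_dstar_eigen 1 l0 hx'); rewrite mul1r; apply; exact: hv.
exists t; split=> //.
have [x [y [z [/andP[xy yz] x0 [hx hy hz]]]]] := dstar_roots R k0 l0.
have sE : (k + l + 4)%:R = x + y + z.
  have xy' : x != y by rewrite lt_eqF.
  have yz' : y != z by rewrite lt_eqF.
  have xz' : x != z by rewrite lt_eqF// (lt_trans xy).
  rewrite (cubic_roots_sum xy' yz' xz' hx hy hz) -!natr1 !natrD; ring.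
have E n : t n * (k + l + 4)%:R = t n * x + t n * y + t n * z by rewrite sE !mulrDr.
have [h1 h2] := cis_cvgD (cis_cvgD (Hr x hx) (Hr y hy)) (Hr z hz).
by rewrite -[X in cis_cvg _ X]mulr1 -[X in cis_cvg _ (X * 1)]mulr1; split;
  under eq_fun do rewrite E.
Qed.

Lemma dstar_eigen_hub_neq0 (R : realType) (k l i : nat) (x : R) :
  (0 < k)%N -> (0 < l)%N -> i = 0%N ->
  x * cubic k.+1%:R l.+1%:R x = 0 -> dstar_eigen k l x i != 0.
Proof.
move=> k0 l0 -> /(root_cubic_neq1 k0 l0).
by rewrite /dstar_eigen /dstar_fun/= subr_eq0 eq_sym.
Qed.

Lemma oner_neqN1 (R : realType) : (1 : R) <> -1.
Proof. by lra. Qed.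

(** For [k = l] the degree [k + 1] is itself a root, so one phase would tend to both 1 and -1. For
    the valuations, [k + l + 4] is split as [(k + 1) + (l + 3)]. *)
Lemma hub_LPGST_only_if (R : realType) (k l : nat) (v : 'I_(k + l + 2)) :
  (0 < k)%N -> (0 < l)%N -> v = 0%N :> nat ->
  LPGST R (blowup2 (@dstar_adj k l)) (ord0, v) (ord_max, v) ->
  k != l /\ nu2 k.+1 = nu2 (l + 3).
Proof.
move=> k0 l0 v0 /(LPGST_blowup2_dstar k0 l0 (sum_dstar_adj_hub R v0))[|t [hd hs hr _]].
  by move=> x; exact: dstar_eigen_hub_neq0.
split.
  apply/eqP => kl; have h0 : cubic k.+1%:R l.+1%:R k.+1%:R = 0 :> R.
    by rewrite /cubic -kl; ring.
  exact: oner_neqN1 (cis_cvg_unique (hr _ h0) hd).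
apply/eqP; apply: contrapT => /negP hnu.
have [|m [m' [hm om']]] := nu2_add_dvd (ltn0Sn k) _ hnu; first by rewrite addn_gt0 orbT.
have h1 := cis_cvgM m hs; have h2 := cis_cvgM m' hd.
have E n : t n * (k + l + 4)%:R * m%:R = t n * k.+1%:R * m'%:R.
  by rewrite -!mulrA -!natrM -hm; congr (_ * _%:R); lia.
rewrite expr1n (_ : (fun n => _) = fun n => t n * k.+1%:R * m'%:R) in h1; last first.
  by apply/funext => n; rewrite E.
have := cis_cvg_unique h1 h2; rewrite -signr_odd om' expr1; exact: oner_neqN1.
Qed.

Lemma dstar_LPGST_roots (R : realType) (k l : nat) (x y z d : R) (a b u w : R)
    (v : 'I_(k + l + 2)) :
  (0 < l)%N -> 0 < x < y -> y < z ->
  cubic k.+1%:R l.+1%:R x = 0 -> cubic k.+1%:R l.+1%:R y = 0 ->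
  cubic k.+1%:R l.+1%:R z = 0 ->
  (forall i : 'I_(k + l + 2), dstar_fun k a b u w i = (i == v)%:R) ->
  \sum_i (dstar_adj v i)%:R = d ->
  (forall e : R, 0 < e -> exists (t : R) (p q r m : int),
    [/\ `|t * x - 2 * pi * p%:~R| < e, `|t * y - 2 * pi * q%:~R| < e,
        `|t * z - 2 * pi * r%:~R| < e & t * d = pi + 2 * pi * m%:~R]) ->
  LPGST R (blowup2 (@dstar_adj k l)) (ord0, v) (ord_max, v).
Proof.
move=> l0 /andP[x0 xy] yz hx hy hz hv hd approx.
(* The fourth eigenvalue is 0, whose phase is always 1. *)
pose lam (j : 'I_4) : R := [:: 0; x; y; z]`_j.
have lamI : injective lam.
  have lam_lt (i j : 'I_4) : (i < j)%N -> lam i < lam j.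
    by rewrite /lam; case: i j => [[|[|[|[|i]]]] hi] [[|[|[|[|j]]]] hj] //= _; lra.
  move=> i j lamij; apply/val_inj/eqP; rewrite eqn_leq.
  by apply/andP; split; rewrite leqNgt; apply/negP => /lam_lt; rewrite lamij ltxx.
apply: (blowup2_dstar_LPGST l0 lamI _ hv hd).
  by rewrite /lam => -[[|[|[|[|j]]]] hj] //=; rewrite ?mul0r ?hx ?hy ?hz ?mulr0.
move=> e e0; have [t [p [q [r [m [h1 h2 h3 h4]]]]]] := approx e e0.
exists t, (fun j => [:: 0; p; q; r]`_j), m; split=> //.
by rewrite /lam => -[[|[|[|[|j]]]] hj] //=; rewrite !mulr0 subr0 normr0.
Qed.

Lemma hub_LPGST_if (R : realType) (k l : nat) (v : 'I_(k + l + 2)) :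
  (0 < k)%N -> (0 < l)%N -> v = 0%N :> nat ->
  k != l -> nu2 k.+1 = nu2 (l + 3) ->
  LPGST R (blowup2 (@dstar_adj k l)) (ord0, v) (ord_max, v).
Proof.
move=> k0 l0 v0 kl hnu.
have [||al [c [d [hs hd od]]]] := @nu2_add_eq k.+1 (l + 3) _ _ hnu; [by []|lia|].
have hs' : (k + l + 4 = 2 ^ al * c.*2)%N by rewrite -hs; lia.
have [x [y [z [/andP[xy yz] x0 [hx hy hz]]]]] := dstar_roots R k0 l0.
apply: (@dstar_LPGST_roots R k l x y z k.+1%:R 1 0 0 0) => //.
- by rewrite x0.
- move=> i; rewrite -val_eqE/= v0 /dstar_fun; case: eqP => //= _.
  by case: ifP => //; case: ifP.
- exact: sum_dstar_adj_hub.
- rewrite hd; apply: (kronecker_dstar k0 l0 kl _ _ _ hx hy hz hs' od).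
  + by rewrite lt_eqF.
  + by rewrite lt_eqF.
  + by rewrite lt_eqF// (lt_trans xy).
Qed.

(** For [l] other than 1, the degree 1 of the leaf is also an eigenvalue in its support. Since the
    phase at 1 tends to -1, that at [k + l + 4] tends to 1 only if this number is even. *)
Lemma leaf_LPGST_only_if (R : realType) (k l : nat) (w : 'I_(k + l + 2)) :
  (0 < k)%N -> (0 < l)%N -> (k + 2 <= w)%N ->
  LPGST R (blowup2 (@dstar_adj k l)) (ord0, w) (ord_max, w) -> l = 1%N /\ odd k.
Proof.
move=> k0 l0 hw /(LPGST_blowup2_dstar k0 l0 (sum_dstar_adj_leaf R hw))[|t [hd hs hr hf]].
  by move=> x; exact: dstar_eigen_leaf_neq0.
have l1 : l = 1%N.
  have [//|l1] := eqVneq l 1%N; exfalso.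
  have hw' : (k + 2 <= w < k + l + 2)%N by rewrite hw ltn_ord.
  have := hf _ _ (eigenfun_dstar_leaf R hw'); rewrite /= hw eqxx mulr1.
  by rewrite subr_eq0 (eqr_nat R l 1) l1 => /(_ isT) h; have /oner_neqN1 := cis_cvg_unique h hd.
split=> //; have h : cis_cvg (fun n => t n * (k + l + 4)%:R) ((-1) ^+ (k + l + 4)).
  by have [h1 h2] := cis_cvgM (k + l + 4) hd; split;
    [move: h1|move: h2]; under eq_fun do rewrite mulr1.
have := cis_cvg_unique hs h; rewrite -signr_odd l1 !oddD/= addbF addbT.
by case: (odd k) => //= /oner_neqN1.
Qed.

Lemma leaf_LPGST_if (R : realType) (k : nat) (w : 'I_(k + 1 + 2)) :
  odd k -> (k + 2 <= w)%N ->
  LPGST R (blowup2 (@dstar_adj k 1)) (ord0, w) (ord_max, w).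
Proof.
move=> ok hw; have k0 : (0 < k)%N by case: (k) ok.
have [x [y [z [/andP[xy yz] x0 [hx hy hz]]]]] := @dstar_roots R k 1 k0 isT.
have xy' : x != y by rewrite lt_eqF.
have yz' : y != z by rewrite lt_eqF.
have xz' : x != z by rewrite lt_eqF// (lt_trans xy).
apply: (@dstar_LPGST_roots R k 1 x y z 1 0 0 0 1) => //.
- by rewrite x0.
- move=> i; rewrite -val_eqE/= /dstar_fun; have := ltn_ord w; have := ltn_ord i => hi hw'.
  have -> : (i == w :> nat) = ~~ (i < k + 2)%N by lia.
  by case: i hi => -[|[|i]] hi hi' /=; rewrite ?addn2//; case: ifP.
- exact: sum_dstar_adj_leaf.
(* For [k] other than 1, Kronecker applies with [al = 0] and [d = 1], the root sum [k + 5] being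
   even. *)
have [k1|k1] := eqVneq k 1%N; last first.
  have hs : (k + 1 + 4 = 2 ^ 0 * (k + 5)./2.*2)%N.
    by rewrite mul1n -addnA -[LHS]odd_double_half oddD ok.
  exact: (@kronecker_dstar R k 1 (k + 5)./2 1 0 x y z).
move: hx hy hz; rewrite k1 => hx hy hz.
have h2 : cubic 2 2 2 = 0 :> R by rewrite /cubic; ring.
have hs := cubic_roots_sum xy' yz' xz' hx hy hz.
have y2 : y = 2.
  (* The roots sum to 6, so the root 2 can be neither the smallest nor the largest. *)
  by case: (cubic_root_cases xy' yz' xz' hx hy hz h2) => E //; lra.
pose s := 2 - x.
have s2 : s ^+ 2 = 2.
  have : (x - 2) * (s ^+ 2 - 2) = 0 by rewrite -hx /s /cubic; ring.
  by move/eqP; rewrite mulf_eq0 !subr_eq0 -{1}y2 (negbTE xy') => /eqP.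
have s0 : 0 < s by rewrite /s -y2; lra.
move=> e e0; have pi0 := @pi_gt0 R.
have [a [b [ob hab]]] := pell_approx s0 s2 (divr_gt0 e0 pi0).
have hab' : pi * `|b%:R * s - a.*2%:R| < e by rewrite mulrC -ltr_pdivlMr.
have [h bE] : exists h, b = h.*2.+1.
  by exists b./2; rewrite -[LHS]odd_double_half ob.
(* The time is an odd multiple of [pi]. The outer roots are [2 - s] and [2 + s], and [b * s] is
   close to [2 * a], hence the integers [b - a] and [b + a]. *)
exists (pi * b%:R), (b%:Z - a%:Z), b%:Z, (b%:Z + a%:Z), h%:Z; split.
- rewrite (_ : _ - _ = - (pi * (b%:R * s - a.*2%:R))).
    by rewrite normrN normrM gtr0_norm.
  by rewrite /s rmorphB/= -!pmulrn -muln2 natrM; ring.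
- by rewrite y2 -pmulrn (_ : _ - _ = 0) ?normr0//; ring.
- rewrite (_ : _ - _ = pi * (b%:R * s - a.*2%:R)); first by rewrite normrM gtr0_norm.
  have -> : z = 4 - x by move: hs; rewrite y2; lra.
  by rewrite /s rmorphD/= -!pmulrn -muln2 natrM; ring.
- by rewrite bE -natr1 -muln2 natrM -pmulrn; ring.
Qed.

Theorem theorem9 (R : realType) (k l : nat) (hk : (1 <= k)%N) (hl : (1 <= l)%N) :
  (* (1) v = x, the vertex of degree k+1 *)
  (forall v : 'I_(k + l + 2), (v = 0%N :> nat) ->
    (LPGST R (blowup2 (@dstar_adj k l)) (ord0, v) (ord_max, v)
       <-> irreducible_poly (dstar_p k l) /\ nu2 k.+1 = nu2 (l + 3)))
  /\
  (* (2) w any of the leaves k+2..k+l+1 attached to y (the vertex of degree l+1) *)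
  (forall w : 'I_(k + l + 2), (k + 2 <= w)%N ->
    (LPGST R (blowup2 (@dstar_adj k l)) (ord0, w) (ord_max, w)
       <-> [/\ l = 1%N, odd k &
              (irreducible_poly (dstar_p k l)
               \/ exists z : int, root (dstar_p k l) z%:~R /\ (2 %| z)%Z)])).
Proof.
split=> [v v0|w hw]; split.
- by move=> /(hub_LPGST_only_if hk hl v0)[/(dstar_p_irreducible R hk hl)].
- by case=> /(dstar_p_irreducible R hk hl) kl; exact: hub_LPGST_if.
- move=> /(leaf_LPGST_only_if hk hl hw)[l1 ok]; split=> //.
  have [k1|k1] := eqVneq k 1%N; last first.
    by left; apply/(dstar_p_irreducible R hk hl); rewrite l1.
  right; exists 2; split=> //.
  by apply/rootP; rewrite horner_dstar_p k1 l1 /cubic; ring.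
- by case=> l1 ok _; subst l; exact: leaf_LPGST_if.
Qed.
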